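(* Let $\mathfrak{h}=\{\tau\in\mathbb{C}:\operatorname{Im}\tau>0\}$. Let $Z(\tau)$, $X(\tau)$, $U(\tau)$ be meromorphic functions on $\mathfrak{h}$ such that $\frac{1}{2\pi i}\frac{d}{d\tau}X(\tau)=U(\tau)X(\tau)Z(\tau)$, and suppose that for $\tau\in D$, a domain of $\mathfrak{h}$, $$Z(\tau)=X(\tau)^{\varepsilon_0}(1-X(\tau))^{\varepsilon_1}\sum_{j=0}^\infty A_jX(\tau)^j$$ for some $\varepsilon_0,\varepsilon_1\in\mathbb{R}$ and $A_j\in\mathbb{C}$. Further assume there exist $\alpha,\beta\in\mathbb{C}$, $N,k\in\mathbb{N}$, and elements $\gamma=\begin{pmatrix} a & b \\ c & -a \end{pmatrix}$, $\delta=\begin{pmatrix} 1 & \frac{a}{c}(1-N) \\ 0 & 1 \end{pmatrix}$ in $\mathrm{SL}_2(\mathbb{R})$ such that for any $\tau\in\mathfrak{h}$, $$(Z|_k\gamma)(\tau)=\alpha Z(\tau),\qquad (Z|_k\delta)(\tau)=\beta Z(\tau).$$ Set $M_N(\tau):=Z(\tau)/Z(N\tau)$ and let $\tau_0=\frac{a}{c}+\frac{i}{c\sqrt N}$. Then (all quantities appearing being well defined, in the sense specified in the context): (1) If $\tau_0\in D$, then $$\frac{ck\sqrt N}{2\pi}=U(\tau_0)X(\tau_0)^{\varepsilon_0}(1-X(\tau_0))^{\varepsilon_1}\sum_{j\ge0}(2j+a_N)A_jX(\tau_0)^j,$$ where $$a_N=2\left(\varepsilon_0+\varepsilon_1\frac{X(\tau_0)}{X(\tau_0)-1}\right)-\frac{\alpha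 i^k}{\beta N^{k/2}}X(\tau_0)\left.\frac{dM_N}{dX}\right|_{X=X(\tau_0)}.$$ (2) Alternatively, if $\gamma\tau_0\in D$, then $$\frac{ck\sqrt N}{2\pi}=X(\gamma\tau_0)^{\varepsilon_0}(1-X(\gamma\tau_0))^{\varepsilon_1}\sum_{j\ge0}(b_N'j+a_N')A_jX(\gamma\tau_0)^j,$$ where $$b_N'=2NU(\gamma\tau_0),$$ $$a_N'=2NU(\gamma\tau_0)\left(\varepsilon_0+\varepsilon_1\frac{X(\gamma\tau_0)}{X(\gamma\tau_0)-1}\right)+\frac1\beta U(\tau_0)X(\tau_0)\left.\frac{dM_N}{dX}\right|_{X=X(\tau_0)}.$$
   Context: $\mathbb{N}$ is the set of positive integers. For $A=\begin{pmatrix} p & q \\ r & s \end{pmatrix}\in\mathrm{SL}_2(\mathbb{R})$, $A\tau=\frac{p\tau+q}{r\tau+s}$, and the weight-$k$ slash operator is $(f|_kA)(\tau)=(r\tau+s)^{-k}f(A\tau)$. A domain is a nonempty connected open set. The powers $X^{\varepsilon_0}$ and $(1-X)^{\varepsilon_1}$ denote fixed holomorphic branches on $D$, the same ones in the hypothesis and in the conclusion. The notation $\frac{dM_N}{dX}\big|_{X=X(\tau_0)}$ means the chain-rule quotient $\frac{dM_N}{d\tau}(\tau_0)\big/\frac{dX}{d\tau}(\tau_0)$. Well-definedness convention: $X,U,Z$ are holomorphic at $\tau_0$ (and, in case (2), also at $\gamma\tau_0$), $\frac{dX}{d\tau}(\tau_0)\neq0$, and, if $\varepsilon_1\ne0$,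 $X\neq1$ at $\tau_0$ in case (1), respectively at $\gamma\tau_0$ in case (2). Note that $\tau_0\in D$ or $\gamma\tau_0\in D$ forces $c>0$. *)

(* Defs.v *)
From Stdlib Require Import Reals.
From Coquelicot Require Import Coquelicot.

Open Scope R_scope.

Definition upper_half_plane (t : C) : Prop := 0 < Im t.

Definition connected_set (D : C -> Prop) : Prop :=
  forall V W : C -> Prop, open V -> open W ->
    (forall z, D z -> V z \/ W z) ->
    (exists z, D z /\ V z) -> (exists z, D z /\ W z) ->
    exists z, D z /\ V z /\ W z.

Definition complex_domain (D : C -> Prop) : Prop :=
  (exists z, D z) /\ open D /\ connected_set D.

Definition complex_differentiable (f : C -> C) (z : C) : Prop :=
  ex_derive (K := C_AbsRing) (V := C_NormedModule) f z.

Definition holomorphic_at (f : C -> C) (z : C) : Prop :=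
  locally z (complex_differentiable f).

Definition pole_at (f : C -> C) (z : C) : Prop :=
  locally' z (complex_differentiable f) /\
  filterlim (fun w => Cmod (f w)) (locally' z) (Rbar_locally p_infty).

(* A meromorphic function is represented by a total function whose values at
   its poles are irrelevant; there are no removable singularities, since each
   point is either a point of holomorphy or a genuine pole. Accordingly, an
   identity between meromorphic functions is stated at the points where all the
   functions that occur in it are holomorphic. *)
Definition meromorphic_on (D : C -> Prop) (f : C -> C) : Prop :=
  forall z, D z -> holomorphic_at f z \/ pole_at f z.

Definition Cexp (z : C) : C := (RtoC (exp (Re z)) * (cos (Im z), sin (Im z)))%C.

(* [g] is a holomorphic branch of the real power [f ^ e] on [D]. A zero of [f]
   is allowed in [D] when [0 <= e], and there the branch takes the value 0 ^ e. *)
Definition holomorphic_power (D : C -> Prop) (f : C -> C) (e : R) (g : C -> C) :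
    Prop :=
  forall t, D t -> holomorphic_at f t ->
    holomorphic_at g t /\
    (f t <> 0%C ->
       exists L : C -> C, holomorphic_at L t /\
         locally t (fun w => Cexp (L w) = f w /\ g w = Cexp (RtoC e * L w)%C)) /\
    (f t = 0%C -> (e = 0 /\ g t = 1%C) \/ (0 < e /\ g t = 0%C)).

Record mat2 := Mat2 { m11 : R; m12 : R; m21 : R; m22 : R }.

Definition in_SL2 (M : mat2) : Prop := m11 M * m22 M - m12 M * m21 M = 1.

Definition automorphy (M : mat2) (t : C) : C := (RtoC (m21 M) * t + RtoC (m22 M))%C.

Definition mobius (M : mat2) (t : C) : C :=
  ((RtoC (m11 M) * t + RtoC (m12 M)) / automorphy M t)%C.

Definition slash (k : nat) (f : C -> C) (M : mat2) (t : C) : C :=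
  (/ (automorphy M t ^ k) * f (mobius M t))%C.

Definition slash_eigen (k : nat) (f : C -> C) (M : mat2) (lambda : C) : Prop :=
  forall t, upper_half_plane t ->
    holomorphic_at f t -> holomorphic_at f (mobius M t) ->
    slash k f M t = (lambda * f t)%C.

Definition multiplier (N : nat) (Z : C -> C) (t : C) : C :=
  (Z t / Z (RtoC (INR N) * t))%C.

(* The chain-rule quotient (df/dt) / (dX/dt), i.e. df/dX at X = X(t). *)
Definition derive_wrt (f X : C -> C) (t : C) : C := (C_derive f t / C_derive X t)%C.

(* Main.v *)
(** Let tau1 = gamma tau0 and h = (a/c)(1 - N), so that N tau0 + h = tau1. The delta-equation turns the multiplier
    into M_N(t) = beta Z(t) / Z(N t + h) near tau0, whose logarithmic derivative at tau0 is
    Z'/Z(tau0) - N Z'/Z(tau1). Differentiating Z(gamma t) = alpha (c t - a)^k Z(t) at tau0,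
    where c tau0 - a = i / sqrt N and gamma'(tau0) = -N, gives
    Z'/Z(tau0) + N Z'/Z(tau1) = i k c sqrt N. Eliminating one of the two logarithmic
    derivatives and computing the other one from Z = X^e0 (1-X)^e1 sum A_j X^j and
    X' = 2 pi i U X Z yields (1) and (2).

    At tau0 the derivative of X is nonzero, but at tau1 it may vanish, and then X(tau1) could
    a priori lie on the circle of convergence. The series is nevertheless differentiated along
    X: either |X| takes values larger than |X(tau1)| arbitrarily close to tau1, and X(tau1) is
    interior to the disk of convergence, or X is locally constant by the maximum principle. *)

Require Import Defs.
From Stdlib Require Import Reals Lra Lia Classical IndefiniteDescription.
From Coquelicot Require Import Coquelicot.

(** * Complex derivatives *)

(** Two obstacles shape the proof. First, the slash equations hold only where [Z] is holomorphic on
    both sides, and in case (1) nothing is assumed about [Z] at tau1 or at N tau0. Holomorphy there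
    is forced: the equation, valid on a punctured neighbourhood, bounds [Z], and a bounded [Z] has
    no pole. That [Z] does not vanish at tau0 comes from X'(tau0) <> 0 through the differential
    equation; this passes to tau1 and makes [beta] nonzero. Second, the continuity of X' is not
    taken from Cauchy's theorem: X' = 2 pi i U X Z is a product of continuous functions. This
    suffices for an elementary mean value property, obtained by differentiating a circle integral
    under the integral sign, and hence for the maximum principle. The constant alpha i^k / (beta
    N^(k/2)) in a_N is Z(tau1) / (beta Z(tau0)), by the slash equation at tau0. *)

Notation is_cderive :=
  (is_derive (K := C_AbsRing) (V := C_NormedModule)) (only parsing).

Lemma locally_Cmod (z : C) (P : C -> Prop) :
  locally z P <-> exists d : posreal, forall w : C, Cmod (w - z) < d -> P w.
Proof.
rewrite locally_C; split; intros [d H]; exists d; intros w Hw.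
- now apply H.
- now apply H.
Qed.

(* Coquelicot puts two uniform structures on [C]: balls of [Cmod] on [C_AbsRing] and products
   of intervals on [C_NormedModule], so that its generic rules for products and compositions
   and its topological statements about [C] live on types that are not convertible. *)
Lemma is_cderive_AbsRing (f : C -> C) (z l : C) :
  is_derive (K := C_AbsRing) (V := AbsRing_NormedModule C_AbsRing) f z l <->
  is_cderive f z l.
Proof.
split; intros [[Hp Hs Hn] H]; (split; [split; [exact Hp | exact Hs | exact Hn] | exact H]).
Qed.

Lemma is_cderive_eps (f : C -> C) (z l : C) :
  is_cderive f z l <->
  forall eps : posreal, exists d : posreal, forall w : C, Cmod (w - z) < d ->
    Cmod (f w - f z - (w - z) * l) <= eps * Cmod (w - z).
Proof.
split.
- intros [_ H] eps.
  destruct (H z (fun P HP => HP) eps) as [d Hd].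
  exists d; intros w Hw. exact (Hd w Hw).
- intros H; split.
  + apply (is_linear_scal_l (K := C_AbsRing) (V := C_NormedModule)).
  + intros x Hx eps.
    rewrite <- (is_filter_lim_locally_unique _ _ Hx).
    destruct (H eps) as [d Hd].
    exists d; intros w Hw. exact (Hd w Hw).
Qed.

Lemma is_cderive_ext_loc (f g : C -> C) (z l : C) :
  locally z (fun w => f w = g w) -> is_cderive f z l -> is_cderive g z l.
Proof.
intros H; apply is_derive_ext_loc; now apply locally_C.
Qed.

Lemma is_cderive_continuous (f : C -> C) (z l : C) :
  is_cderive f z l -> continuous f z.
Proof.
intros H P HP.
apply locally_C.
exact (ex_derive_continuous (K := C_AbsRing) (V := C_NormedModule) f z (ex_intro _ l H) P HP).
Qed.

Lemma is_cderive_unique (f : C -> C) (z l1 l2 : C) :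
  is_cderive f z l1 -> is_cderive f z l2 -> l1 = l2.
Proof.
intros H1 H2.
now rewrite <- (is_C_derive_unique f z l1 H1), <- (is_C_derive_unique f z l2 H2).
Qed.

Lemma is_cderive_const (c z : C) : is_cderive (fun _ => c) z (RtoC 0).
Proof. apply (is_derive_const (K := C_AbsRing) (V := C_NormedModule)). Qed.

Lemma is_cderive_id (z : C) : is_cderive (fun w => w) z (RtoC 1).
Proof. apply is_cderive_AbsRing, (is_derive_id (K := C_AbsRing)). Qed.

Lemma is_cderive_plus (f g : C -> C) (z df dg : C) :
  is_cderive f z df -> is_cderive g z dg ->
  is_cderive (fun w => (f w + g w)%C) z (df + dg)%C.
Proof. apply (is_derive_plus (K := C_AbsRing) (V := C_NormedModule)). Qed.

Lemma is_cderive_mult (f g : C -> C) (z df dg : C) :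
  is_cderive f z df -> is_cderive g z dg ->
  is_cderive (fun w => (f w * g w)%C) z (df * g z + f z * dg)%C.
Proof.
intros Hf Hg; apply is_cderive_AbsRing.
apply (is_derive_mult (K := C_AbsRing)); [now apply is_cderive_AbsRing .. | apply Cmult_comm].
Qed.

Lemma is_cderive_comp (f g : C -> C) (z df dg : C) :
  is_cderive f (g z) df -> is_cderive g z dg ->
  is_cderive (fun w => f (g w)) z (dg * df)%C.
Proof.
intros Hf Hg.
apply (is_derive_comp (K := C_AbsRing) (V := C_NormedModule)); trivial.
now apply is_cderive_AbsRing.
Qed.

Lemma is_cderive_eq (f : C -> C) (z l1 l2 : C) :
  is_cderive f z l1 -> l1 = l2 -> is_cderive f z l2.
Proof. now intros H <-. Qed.

Lemma is_cderive_scal (c : C) (f : C -> C) (z df : C) :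
  is_cderive f z df -> is_cderive (fun w => (c * f w)%C) z (c * df)%C.
Proof.
intros H; eapply is_cderive_eq.
- apply is_cderive_mult; [apply is_cderive_const | exact H].
- cbv beta; ring.
Qed.

Lemma is_cderive_opp (f : C -> C) (z df : C) :
  is_cderive f z df -> is_cderive (fun w => (- f w)%C) z (- df)%C.
Proof. apply (is_derive_opp (K := C_AbsRing) (V := C_NormedModule)). Qed.

Lemma Cmod_sub_lower (u v : C) : Cmod u - Cmod (v - u) <= Cmod v.
Proof.
assert (H := Cmod_triangle v (- (v - u))%C).
replace (v + - (v - u))%C with u in H by ring.
rewrite Cmod_opp in H. lra.
Qed.

Lemma is_cderive_Cinv (z : C) : z <> 0%C -> is_cderive Cinv z (- / (z * z))%C.
Proof.
intros Hz; apply is_cderive_eps; intros eps.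
assert (Pz : 0 < Cmod z) by now apply Cmod_gt_0.
(* The first bound keeps [Cmod w] above [Cmod z / 2]; the second then makes the factor
   [(w - z) / (w * (z * z))] of the remainder at most [eps]. *)
assert (Pd : 0 < Rmin (Cmod z / 2) (eps * (Cmod z * Cmod z * Cmod z / 2))).
{ destruct eps as [e He]; simpl.
  apply Rmin_pos; [lra |]. apply Rmult_lt_0_compat; trivial.
  assert (0 < Cmod z * Cmod z * Cmod z) by (repeat apply Rmult_lt_0_compat; trivial). lra. }
exists (mkposreal _ Pd); simpl; intros w Hw.
assert (Hw1 := Rlt_le_trans _ _ _ Hw (Rmin_l _ _)).
assert (Hw2 := Rlt_le_trans _ _ _ Hw (Rmin_r _ _)).
assert (Pw : Cmod z / 2 <= Cmod w) by (generalize (Cmod_sub_lower z w); lra).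
assert (Hw0 : w <> 0%C) by (apply Cmod_gt_0; lra).
replace (/ w - / z - (w - z) * - / (z * z))%C
  with ((w - z) * ((w - z) / (w * (z * z))))%C by (field; auto).
rewrite Cmod_mult, Rmult_comm. apply Rmult_le_compat_r; [apply Cmod_ge_0 |].
rewrite Cmod_div by (repeat apply Cmult_neq_0; auto).
rewrite !Cmod_mult.
apply Rle_div_l; [repeat apply Rmult_lt_0_compat; lra |].
apply Rlt_le, (Rlt_le_trans _ _ _ Hw2).
apply Rmult_le_compat_l; [apply Rlt_le, cond_pos |].
replace (Cmod z * Cmod z * Cmod z / 2) with (Cmod z / 2 * (Cmod z * Cmod z)) by field.
apply Rmult_le_compat_r; trivial. apply Rmult_le_pos; lra.
Qed.

Lemma is_cderive_div (f g : C -> C) (z df dg : C) :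
  is_cderive f z df -> is_cderive g z dg -> g z <> 0%C ->
  is_cderive (fun w => (f w / g w)%C) z ((df * g z - f z * dg) / (g z * g z))%C.
Proof.
intros Hf Hg Hz; eapply is_cderive_eq.
- apply is_cderive_mult; [exact Hf |].
  apply (is_cderive_comp Cinv g); [now apply is_cderive_Cinv | exact Hg].
- cbv beta; field; trivial.
Qed.

Lemma is_cderive_pow (f : C -> C) (z df : C) (n : nat) :
  is_cderive f z df ->
  is_cderive (fun w => (f w ^ n)%C) z (RtoC (INR n) * f z ^ pred n * df)%C.
Proof.
intros H; induction n as [|n IH].
- eapply is_cderive_eq; [exact (is_cderive_const 1%C z) |]. simpl; ring.
- eapply is_cderive_eq.
  + apply (is_cderive_mult f (fun w => (f w ^ n)%C)); [exact H | exact IH].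
  + cbv beta. rewrite S_INR, RtoC_plus. destruct n as [|n]; simpl; ring.
Qed.

Lemma is_cderive_holomorphic (f : C -> C) (z : C) :
  holomorphic_at f z -> is_cderive f z (C_derive f z).
Proof.
intros H; apply C_derive_correct; [exact z |]. exact (locally_singleton _ _ H).
Qed.

Lemma holomorphic_at_continuous (f : C -> C) (z : C) :
  holomorphic_at f z -> continuous f z.
Proof.
intros H; exact (is_cderive_continuous _ _ _ (is_cderive_holomorphic _ _ H)).
Qed.

Lemma locally_holomorphic_at (f : C -> C) (z : C) :
  holomorphic_at f z -> locally z (holomorphic_at f).
Proof. apply locally_locally. Qed.

(** * Power series *)

Notation is_cseries := (is_series (K := C_AbsRing) (V := C_NormedModule)) (only parsing).

Lemma is_cseries_unique (u : nat -> C) (l1 l2 : C) :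
  is_cseries u l1 -> is_cseries u l2 -> l1 = l2.
Proof.
intros H1 H2.
exact (filterlim_locally_unique (K := C_AbsRing) (V := C_NormedModule) _ _ _ H1 H2).
Qed.

Lemma is_cseries_0 (u : nat -> C) :
  (forall j, u j = RtoC 0) -> is_cseries u (RtoC 0).
Proof.
intros Hu. apply (filterlim_ext (fun _ => RtoC 0)); [| apply filterlim_const].
intros n; induction n as [|n IH].
- rewrite sum_O. symmetry; apply Hu.
- rewrite sum_Sn, <- IH, Hu. symmetry; apply (plus_zero_l (G := C_NormedModule)).
Qed.

Lemma is_cseries_lin (c d : C) (u v : nat -> C) (l m : C) :
  is_cseries u l -> is_cseries v m ->
  is_cseries (fun j => (c * u j + d * v j)%C) (c * l + d * m)%C.
Proof.
intros Hu Hv.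
apply (is_series_plus (K := C_AbsRing) (V := C_NormedModule));
  now apply (is_series_scal (K := C_AbsRing) (V := C_NormedModule)).
Qed.

Lemma is_cseries_Cmod_le (u : nat -> C) (b : nat -> R) (l : C) (m : R) :
  (forall j, Cmod (u j) <= b j) -> is_cseries u l -> is_series b m -> Cmod l <= m.
Proof.
intros Hub Hu Hb.
assert (H := filterlim_comp _ _ _ _ _ _ _ _ Hu
  (filterlim_norm (K := C_AbsRing) (V := C_NormedModule) l)).
apply (filterlim_le (F := eventually)
  (fun n => norm (sum_n (G := C_NormedModule) u n)) (fun n => sum_n b n) (Cmod l) m).
- exists 0%nat; intros n _. eapply Rle_trans; [apply norm_sum_n_m |].
  apply sum_n_m_le; exact Hub.
- exact H.
- exact Hb.
Qed.

Lemma ex_cseries_dominated (u : nat -> C) (b : nat -> R) :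
  (forall j, Cmod (u j) <= b j) -> ex_series b -> exists l, is_cseries u l.
Proof.
intros Hub Hb.
exact (ex_series_le (K := C_AbsRing) (V := C_CompleteNormedModule) u b Hub Hb).
Qed.

Lemma is_cseries_bounded (u : nat -> C) (l : C) :
  is_cseries u l -> exists B : R, 0 <= B /\ forall j, Cmod (u j) <= B.
Proof.
intros H.
assert (H1 : exists N, forall n, (N <= n)%nat ->
  Cmod (sum_n (G := C_NormedModule) u n - l) < 1).
{ apply (H (fun s : C => Cmod (s - l) < 1)).
  apply (proj2 (locally_Cmod l _)). exists (mkposreal 1 Rlt_0_1). now simpl. }
destruct H1 as [N HN].
(* A term is the difference of two consecutive partial sums, each within 1 of the limit. *)
assert (Htail : forall j, (N < j)%nat -> Cmod (u j) <= 2).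
{ intros [|j] Hj; [lia |].
  assert (H1 := HN j ltac:(lia)). assert (H2 := HN (S j) ltac:(lia)).
  rewrite sum_Sn in H2. change plus with Cplus in H2.
  replace (u (S j)) with
    ((sum_n (G := C_NormedModule) u j + u (S j) - l)
      + - (sum_n (G := C_NormedModule) u j - l))%C by ring.
  eapply Rle_trans; [apply Cmod_triangle |]. rewrite Cmod_opp. lra. }
assert (Hhead : forall M, exists B, 0 <= B /\ forall j, (j <= M)%nat -> Cmod (u j) <= B).
{ induction M as [|M [B [HB IH]]].
  - exists (Cmod (u 0%nat)); split; [apply Cmod_ge_0 |].
    intros j Hj; replace j with 0%nat by lia; apply Rle_refl.
  - exists (B + Cmod (u (S M))). assert (P := Cmod_ge_0 (u (S M))).
    split; [lra |]. intros j Hj.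
    destruct (Nat.eq_dec j (S M)) as [-> |]; [lra |].
    assert (Cmod (u j) <= B) by (apply IH; lia). lra. }
destruct (Hhead N) as [B [HB Hh]]. exists (B + 2); split; [lra |].
intros j; destruct (Nat.le_gt_cases j N) as [Hj | Hj].
- assert (H1 := Hh j Hj). lra.
- assert (H1 := Htail j Hj). lra.
Qed.

(* [INR (S j)] rather than [INR j], so that no term vanishes in d'Alembert's test. *)
Lemma ex_series_sqr_geom (q : R) :
  0 < q < 1 -> ex_series (fun j => INR (S j) * INR (S j) * q ^ j).
Proof.
intros Hq. assert (Hn : forall n, 0 < INR (S n)) by (intros; apply lt_0_INR; lia).
assert (Hp : forall n, 0 < INR (S n) * INR (S n) * q ^ n).
{ intros n. repeat apply Rmult_lt_0_compat; try apply Hn. now apply pow_lt. }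
apply ex_series_Rabs, (ex_series_DAlembert _ q); [lra | |].
- intros n. apply Rgt_not_eq, Hp.
- assert (Hinv : is_lim_seq (fun n => / INR (S n)) 0).
  { apply (is_lim_seq_incr_1 (fun n => / INR n) 0).
    apply (is_lim_seq_inv _ p_infty is_lim_seq_INR). discriminate. }
  assert (H1 : is_lim_seq (fun n => 1 + / INR (S n)) 1).
  { replace (Finite 1) with (Finite (1 + 0)) by (f_equal; ring).
    apply is_lim_seq_plus'; [apply is_lim_seq_const | exact Hinv]. }
  replace (Finite q) with (Finite (q * (1 * 1))) by (f_equal; ring).
  apply (is_lim_seq_ext (fun n => q * ((1 + / INR (S n)) * (1 + / INR (S n))))).
  + intros n.
    assert (P1 := Hp n). assert (P2 := Hp (S n)).
    rewrite Rabs_right by (apply Rle_ge, Rlt_le, Rdiv_lt_0_compat; trivial).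
    assert (P3 := Hn n). rewrite (S_INR (S n)), <- tech_pow_Rmult. field.
    split; [apply pow_nonzero; lra | lra].
  + apply is_lim_seq_mult'; [apply is_lim_seq_const |].
    now apply is_lim_seq_mult'.
Qed.

(** Induction on [j]: with h = x - x0, the remainder for j + 1 is [x] times the one for [j] plus h^2
    j x0^(j-1). The factor [rho * rho] on the left avoids the exponent j - 2, and (j + 1)^2 is a
    convenient majorant of j (j - 1) / 2, the weight summed in [ex_series_sqr_geom]. *)
Lemma Cpow_taylor2 (x0 x : C) (rho : R) (j : nat) :
  0 < rho -> Cmod x0 <= rho -> Cmod x <= rho ->
  rho * rho * Cmod (x ^ j - x0 ^ j - (x - x0) * (RtoC (INR j) * x0 ^ pred j))
    <= Cmod (x - x0) * Cmod (x - x0) * (INR (S j) * INR (S j) * rho ^ j).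
Proof.
intros Hr H0 Hx. set (h := (x - x0)%C).
assert (Ph : 0 <= Cmod h) by apply Cmod_ge_0.
induction j as [|j IH].
- replace (x ^ 0 - x0 ^ 0 - h * (RtoC (INR 0) * x0 ^ pred 0))%C with (RtoC 0) by (simpl; ring).
  rewrite Cmod_0. simpl. nra.
- replace (x ^ S j - x0 ^ S j - h * (RtoC (INR (S j)) * x0 ^ pred (S j)))%C
    with (x * (x ^ j - x0 ^ j - h * (RtoC (INR j) * x0 ^ pred j))
          + h * h * (RtoC (INR j) * x0 ^ pred j))%C.
  2: { unfold h; rewrite S_INR, RtoC_plus. destruct j as [|j]; simpl; ring. }
  set (d := Cmod (x ^ j - x0 ^ j - h * (RtoC (INR j) * x0 ^ pred j))) in IH.
  assert (Hd : rho * rho * Cmod (h * h * (RtoC (INR j) * x0 ^ pred j))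
    <= Cmod h * Cmod h * (INR j * rho ^ S j)).
  { rewrite !Cmod_mult, Cmod_R, (Rabs_right (INR j)) by (apply Rle_ge, pos_INR).
    replace (rho * rho * (Cmod h * Cmod h * (INR j * Cmod (x0 ^ pred j))))
      with (Cmod h * Cmod h * (INR j * (rho * rho * Cmod (x0 ^ pred j)))) by ring.
    apply Rmult_le_compat_l; [nra |].
    destruct j as [|j]; [simpl; lra |].
    apply Rmult_le_compat_l; [apply pos_INR |]. simpl pred. rewrite Cmod_pow.
    replace (rho ^ S (S j)) with (rho * rho * rho ^ j) by (simpl; ring).
    apply Rmult_le_compat_l; [nra |]. apply pow_incr. split; [apply Cmod_ge_0 | exact H0]. }
  eapply Rle_trans; [apply Rmult_le_compat_l; [nra | apply Cmod_triangle] |].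
  rewrite (Cmod_mult x). fold d.
  assert (Hxd : rho * rho * (Cmod x * d)
    <= rho * (Cmod h * Cmod h * (INR (S j) * INR (S j) * rho ^ j))).
  { replace (rho * rho * (Cmod x * d)) with (Cmod x * (rho * rho * d)) by ring.
    apply Rmult_le_compat; trivial; [apply Cmod_ge_0 |].
    apply Rmult_le_pos; [nra | apply Cmod_ge_0]. }
  assert (Pr : 0 <= Cmod h * Cmod h * rho ^ S j).
  { apply Rmult_le_pos; [nra |]. apply pow_le; lra. }
  assert (Pj := pos_INR j). rewrite Rmult_plus_distr_l.
  apply (Rle_trans _ _ _ (Rplus_le_compat _ _ _ _ Hxd Hd)).
  rewrite !S_INR. simpl pow in *. nra.
Qed.

(** Convergence at [x1] bounds the terms [A j * x1 ^ j], so inside the radius [Cmod x1] every series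
    involved is dominated by a multiple of one from [ex_series_sqr_geom]. Subtracting the candidate
    derivative termwise leaves the remainders of [Cpow_taylor2], whose sum is quadratic in x -
    x0. *)
Lemma power_series_derive (A : nat -> C) (x0 x1 s1 : C) :
  is_cseries (fun j => (A j * x1 ^ j)%C) s1 -> Cmod x0 < Cmod x1 ->
  exists (F : C -> C) (F1 : C),
    (forall x, Cmod x < Cmod x1 -> is_cseries (fun j => (A j * x ^ j)%C) (F x)) /\
    is_cseries (fun j => (RtoC (INR j) * A j * x0 ^ pred j)%C) F1 /\
    is_cderive F x0 F1.
Proof.
intros Hs1 H01.
destruct (is_cseries_bounded _ _ Hs1) as [B [HB HAB]].
assert (P0 := Cmod_ge_0 x0).
set (rho := (Cmod x0 + Cmod x1) / 2).
assert (Hr : 0 < rho < Cmod x1) by (unfold rho; lra).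
assert (H0r : Cmod x0 < rho) by (unfold rho; lra).
assert (P1 : 0 < Cmod x1) by lra.
assert (Hq : forall q, 0 < q < Cmod x1 ->
  exists b, is_series (fun j => Cmod (A j) * (INR (S j) * INR (S j) * q ^ j)) b).
{ intros q Hq.
  apply (ex_series_le (K := R_AbsRing) (V := R_CompleteNormedModule) _
    (fun j => B * (INR (S j) * INR (S j) * (q / Cmod x1) ^ j))).
  - intros j. change norm with Rabs.
    assert (Pj := pos_INR (S j)). assert (PA := Cmod_ge_0 (A j)).
    assert (Pqj : 0 <= q ^ j) by (apply pow_le; lra).
    rewrite Rabs_right by (apply Rle_ge; repeat apply Rmult_le_pos; trivial).
    assert (HA := HAB j). rewrite Cmod_mult, Cmod_pow in HA.
    assert (P1j : 0 < Cmod x1 ^ j) by now apply pow_lt.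
    unfold Rdiv. rewrite Rpow_mult_distr, pow_inv.
    replace (B * (INR (S j) * INR (S j) * (q ^ j * / Cmod x1 ^ j)))
      with ((B / Cmod x1 ^ j) * (INR (S j) * INR (S j) * q ^ j)) by (field; lra).
    apply Rmult_le_compat_r; [repeat apply Rmult_le_pos; trivial |].
    apply Rle_div_r; trivial.
  - apply (ex_series_scal_l (K := R_AbsRing) (V := R_NormedModule)), ex_series_sqr_geom.
    split; [apply Rdiv_lt_0_compat; lra | apply Rlt_div_l; lra]. }
assert (HS : forall j, 1 <= INR (S j)) by (intros; rewrite S_INR; generalize (pos_INR j); lra).
assert (HF : forall x, exists l, Cmod x < Cmod x1 ->
  is_cseries (fun j => (A j * x ^ j)%C) l).
(* Outside the disk 0 is a mere default, since choice produces a total function. *)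
{ intros x. destruct (Rlt_dec (Cmod x) (Cmod x1)) as [Hx | Hx]; [| now exists (RtoC 0)].
  set (q := (Cmod x + Cmod x1) / 2). assert (Px := Cmod_ge_0 x).
  destruct (Hq q) as [b Hb]; [unfold q; lra |].
  cut (exists l, is_cseries (fun j => (A j * x ^ j)%C) l); [intros [l Hl]; now exists l |].
  apply (ex_cseries_dominated _ (fun j => Cmod (A j) * (INR (S j) * INR (S j) * q ^ j)));
    [| now exists b].
  intros j. rewrite Cmod_mult, Cmod_pow. apply Rmult_le_compat_l; [apply Cmod_ge_0 |].
  assert (Cmod x ^ j <= q ^ j) by (apply pow_incr; unfold q; lra).
  assert (0 <= Cmod x ^ j) by now apply pow_le.
  specialize (HS j). assert (1 <= INR (S j) * INR (S j)) by nra. nra. }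
apply functional_choice in HF. destruct HF as [F HF].
destruct (Hq rho Hr) as [b Hb].
assert (HF1 : exists F1, is_cseries (fun j => (RtoC (INR j) * A j * x0 ^ pred j)%C) F1).
{ apply (ex_cseries_dominated _
    (fun j => / rho * (Cmod (A j) * (INR (S j) * INR (S j) * rho ^ j)))).
  - intros j. rewrite !Cmod_mult, Cmod_pow, Cmod_R.
    rewrite Rabs_right by (apply Rle_ge, pos_INR).
    assert (PA := Cmod_ge_0 (A j)).
    destruct j as [|j].
    { simpl INR. simpl pow. rewrite !Rmult_0_l.
      repeat apply Rmult_le_pos; try lra. apply Rlt_le, Rinv_0_lt_compat; lra. }
    simpl pred.
    replace (/ rho * (Cmod (A (S j)) * (INR (S (S j)) * INR (S (S j)) * rho ^ S j)))
      with (Cmod (A (S j)) * (INR (S (S j)) * INR (S (S j)) * rho ^ j)) by (simpl pow; field; lra).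
    rewrite (Rmult_comm (INR (S j))), Rmult_assoc.
    apply Rmult_le_compat_l; trivial.
    apply Rmult_le_compat; [apply pos_INR | apply pow_le; lra | |].
    + rewrite (S_INR (S j)). generalize (HS j); nra.
    + apply pow_incr; lra.
  - exists (/ rho * b). now apply (is_series_scal_l (K := R_AbsRing) (V := R_NormedModule)). }
destruct HF1 as [F1 HF1].
exists F, F1; split; [exact HF | split; [exact HF1 |]].
apply is_cderive_eps; intros eps.
assert (Pb : 0 <= b).
{ rewrite <- Cmod_0. apply (is_cseries_Cmod_le (fun _ => RtoC 0) _ _ _) with (3 := Hb).
  - intros j. rewrite Cmod_0. repeat apply Rmult_le_pos;
      (apply Cmod_ge_0 || apply pos_INR || apply pow_le; lra).
  - now apply is_cseries_0. }
(* Within this radius [x] stays in the disk of radius [rho], and the quadratic bound h^2 b / rho^2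
   is at most eps h; [b + 1] keeps the denominator positive when [b] is 0. *)
assert (Pd : 0 < Rmin (rho - Cmod x0) (eps * (rho * rho / (b + 1)))).
{ apply Rmin_pos; [lra |]. apply Rmult_lt_0_compat; [apply cond_pos |].
  apply Rdiv_lt_0_compat; nra. }
exists (mkposreal _ Pd); simpl; intros x Hx.
assert (Hx1 := Rlt_le_trans _ _ _ Hx (Rmin_l _ _)).
assert (Hx2 := Rlt_le_trans _ _ _ Hx (Rmin_r _ _)).
assert (Hxr : Cmod x <= rho).
{ replace x with (x0 + (x - x0))%C by ring.
  eapply Rle_trans; [apply Cmod_triangle | lra]. }
set (h := Cmod (x - x0)) in *. assert (Ph : 0 <= h) by apply Cmod_ge_0.
assert (Hmain : Cmod (F x - F x0 - (x - x0) * F1) <= h * h / (rho * rho) * b).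
{ apply (is_cseries_Cmod_le
    (fun j => (1 * (1 * (A j * x ^ j) + - (1) * (A j * x0 ^ j))
               + - (x - x0) * (RtoC (INR j) * A j * x0 ^ pred j))%C)
    (fun j => h * h / (rho * rho) * (Cmod (A j) * (INR (S j) * INR (S j) * rho ^ j)))).
  - intros j.
    replace (1 * (1 * (A j * x ^ j) + - (1) * (A j * x0 ^ j))
               + - (x - x0) * (RtoC (INR j) * A j * x0 ^ pred j))%C
      with (A j * (x ^ j - x0 ^ j - (x - x0) * (RtoC (INR j) * x0 ^ pred j)))%C by ring.
    rewrite Cmod_mult.
    replace (h * h / (rho * rho) * (Cmod (A j) * (INR (S j) * INR (S j) * rho ^ j)))
      with (Cmod (A j) * (h * h * (INR (S j) * INR (S j) * rho ^ j) / (rho * rho))) by (field; lra).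
    apply Rmult_le_compat_l; [apply Cmod_ge_0 |].
    apply Rle_div_r; [nra |]. rewrite Rmult_comm. apply Cpow_taylor2; lra.
  - replace (F x - F x0 - (x - x0) * F1)%C
      with (1 * (1 * F x + - (1) * F x0) + - (x - x0) * F1)%C by ring.
    apply is_cseries_lin; [apply is_cseries_lin; apply HF; lra | exact HF1].
  - now apply (is_series_scal_l (K := R_AbsRing) (V := R_NormedModule)). }
apply (Rle_trans _ _ _ Hmain).
replace (h * h / (rho * rho) * b) with (h * b / (rho * rho) * h) by (field; lra).
apply Rmult_le_compat_r; trivial.
apply Rle_div_l; [nra |].
apply Rle_trans with (h * (b + 1)); [nra |].
apply Rle_div_r; [lra |]. apply Rlt_le. unfold Rdiv in *. rewrite Rmult_assoc. exact Hx2.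
Qed.

(** * Holomorphic branches of powers *)

Lemma Cmod_le_Re_Im (z : C) : Cmod z <= Rabs (Re z) + Rabs (Im z).
Proof.
replace z with (RtoC (Re z) + Ci * RtoC (Im z))%C at 1
  by (destruct z; apply injective_projections; simpl; ring).
eapply Rle_trans; [apply Cmod_triangle |].
rewrite Cmod_mult, Cmod_Ci, !Cmod_R. lra.
Qed.

Lemma im_le_Cmod (z : C) : Rabs (Im z) <= Cmod z.
Proof. exact (Rle_trans _ _ _ (Rmax_r _ _) (Rmax_Cmod z)). Qed.

Lemma is_derive_eps (f : R -> R) (x l : R) :
  is_derive f x l ->
  forall eps : posreal, exists d : posreal, forall y : R, Rabs (y - x) < d ->
    Rabs (f y - f x - (y - x) * l) <= eps * Rabs (y - x).
Proof.
intros [_ H] eps.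
destruct (H x (fun P HP => HP) eps) as [d Hd].
exists d; intros y Hy. exact (Hd y Hy).
Qed.

Lemma Cexp_plus (z w : C) : Cexp (z + w) = (Cexp z * Cexp w)%C.
Proof.
unfold Cexp; destruct z as [x y], w as [x' y']; simpl.
rewrite exp_plus, cos_plus, sin_plus.
apply injective_projections; simpl; ring.
Qed.

Lemma Cexp_0 : Cexp 0 = 1%C.
Proof.
unfold Cexp; simpl. rewrite exp_0, cos_0, sin_0.
apply injective_projections; simpl; ring.
Qed.


Lemma is_cderive_Cexp_0 : is_cderive Cexp (RtoC 0) (RtoC 1).
Proof.
apply is_cderive_eps; intros eps.
(* The estimates [E1] and [E2] below cost three and four times eps / 7 times [Cmod w]. *)
assert (Pe : 0 < eps / 7) by (generalize (cond_pos eps); lra).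
set (e := mkposreal _ Pe).
destruct (is_derive_eps exp 0 (exp 0) (is_derive_exp 0) e) as [d1 H1].
destruct (is_derive_eps cos 0 (- sin 0) (is_derive_cos 0) e) as [d2 H2].
destruct (is_derive_eps sin 0 (cos 0) (is_derive_sin 0) e) as [d3 H3].
rewrite exp_0 in H1; rewrite cos_0, sin_0 in H2, H3.
(* The bound 1 gives |1 + x| <= 2, and the bound [e] controls the cross term [x * y]. *)
assert (Pd : 0 < Rmin (Rmin d1 (Rmin d2 d3)) (Rmin 1 e))
  by (repeat apply Rmin_pos; try apply cond_pos; lra).
exists (mkposreal _ Pd); intros w Hw; simpl in Hw.
replace (w - 0)%C with w in * by ring. rewrite Cexp_0.
assert (Hx := re_le_Cmod w). assert (Hy := im_le_Cmod w).
assert (A1 := Rlt_le_trans _ _ _ Hw (Rmin_l _ _)).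
assert (A2 := Rlt_le_trans _ _ _ Hw (Rmin_r _ _)).
assert (A3 := Rlt_le_trans _ _ _ A1 (Rmin_l _ _)).
assert (A4 := Rlt_le_trans _ _ _ A1 (Rmin_r _ _)).
assert (A5 := Rlt_le_trans _ _ _ A4 (Rmin_l _ _)).
assert (A6 := Rlt_le_trans _ _ _ A4 (Rmin_r _ _)).
assert (A7 := Rlt_le_trans _ _ _ A2 (Rmin_l _ _)).
assert (A8 := Rlt_le_trans _ _ _ A2 (Rmin_r _ _)).
destruct w as [x y]; simpl in Hx, Hy.
specialize (H1 x). specialize (H2 y). specialize (H3 y).
rewrite Rminus_0_r in H1, H2, H3.
specialize (H1 ltac:(lra)). specialize (H2 ltac:(lra)). specialize (H3 ltac:(lra)).
simpl pos in *.
apply (Rle_trans _ _ _ (Cmod_le_Re_Im _)).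
unfold Cexp; simpl.
set (ex := exp x) in *; set (cy := cos y) in *; set (sy := sin y) in *.
assert (Bc : Rabs cy <= 1) by (apply Rabs_le, COS_bound).
assert (Bs : Rabs sy <= 1) by (apply Rabs_le, SIN_bound).
assert (B1 : Rabs (1 + x) <= 2).
{ eapply Rle_trans; [apply Rabs_triang |]. rewrite Rabs_R1. lra. }
assert (Px := Rabs_pos x). assert (Py := Rabs_pos y).
match goal with |- Rabs ?u + Rabs ?v <= _ =>
  replace u with ((ex - 1 - x * 1) * cy + (1 + x) * (cy - 1 - y * - 0)) by ring;
  replace v with ((ex - 1 - x * 1) * sy + ((1 + x) * (sy - 0 - y * 1) + x * y)) by ring
end.
assert (E1 : Rabs ((ex - 1 - x * 1) * cy + (1 + x) * (cy - 1 - y * - 0))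
  <= eps / 7 * Rabs x + 2 * (eps / 7 * Rabs y)).
{ eapply Rle_trans; [apply Rabs_triang |]. rewrite !Rabs_mult.
  apply Rplus_le_compat; [| apply Rmult_le_compat; auto using Rabs_pos].
  rewrite <- (Rmult_1_r (eps / 7 * Rabs x)). apply Rmult_le_compat; auto using Rabs_pos. }
assert (E2 : Rabs ((ex - 1 - x * 1) * sy + ((1 + x) * (sy - 0 - y * 1) + x * y))
  <= eps / 7 * Rabs x + (2 * (eps / 7 * Rabs y) + eps / 7 * Rabs y)).
{ eapply Rle_trans; [apply Rabs_triang |]. rewrite !Rabs_mult.
  apply Rplus_le_compat.
  - rewrite <- (Rmult_1_r (eps / 7 * Rabs x)). apply Rmult_le_compat; auto using Rabs_pos.
  - eapply Rle_trans; [apply Rabs_triang |]. rewrite !Rabs_mult.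
    apply Rplus_le_compat; [apply Rmult_le_compat; auto using Rabs_pos |].
    apply Rmult_le_compat_r; trivial. lra. }
assert (eps / 7 * Rabs x <= eps / 7 * Cmod (x, y)) by (apply Rmult_le_compat_l; lra).
assert (eps / 7 * Rabs y <= eps / 7 * Cmod (x, y)) by (apply Rmult_le_compat_l; lra).
lra.
Qed.

Lemma is_cderive_Cexp (z : C) : is_cderive Cexp z (Cexp z).
Proof.
apply (is_cderive_ext_loc (fun w => (Cexp z * Cexp (w + - z))%C)).
{ apply filter_forall; intros w. rewrite <- Cexp_plus. f_equal; ring. }
eapply is_cderive_eq.
- apply is_cderive_scal, (is_cderive_comp Cexp (fun w => (w + - z)%C)).
  + replace (z + - z)%C with (RtoC 0) by ring. apply is_cderive_Cexp_0.
  + apply is_cderive_plus; [apply is_cderive_id | apply is_cderive_const].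
- ring.
Qed.

(** Away from zeros f = exp L and g = exp (e L) locally, so f' = L' f and g' = e L' g; eliminating
    L' gives the formula. *)
Lemma holomorphic_power_derive (D : C -> Prop) (f g : C -> C) (e : R) (t df : C) :
  open D -> holomorphic_power D f e g -> D t -> holomorphic_at f t ->
  is_cderive f t df -> f t <> 0%C \/ e = 0 ->
  is_cderive g t (RtoC e * (df / f t) * g t)%C.
Proof.
intros HD Hg Dt Hf Hdf Hne.
destruct (classic (e = 0)) as [-> | He].
(* With exponent 0 the branch is 1 all around [t], at zeros of [f] by definition and elsewhere as
   [Cexp 0]. The factor 0 absorbs the quotient by [f t], which may be a division by zero. *)
- apply (is_cderive_ext_loc (fun _ => 1%C)).
  + generalize (filter_and _ _ (HD t Dt) (locally_holomorphic_at f t Hf)).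
    apply filter_imp; intros w [Dw Hw].
    destruct (Hg w Dw Hw) as [_ [Hnz Hz]].
    destruct (classic (f w = 0%C)) as [E | E].
    * destruct (Hz E) as [[_ ->] | [H _]]; [easy | lra].
    * destruct (Hnz E) as [L [_ HL]].
      destruct (locally_singleton _ _ HL) as [_ ->].
      rewrite Cmult_0_l. symmetry; apply Cexp_0.
  + eapply is_cderive_eq; [apply is_cderive_const | ring].
- assert (Hft : f t <> 0%C) by tauto.
  destruct (Hg t Dt Hf) as [_ [Hnz _]].
  destruct (Hnz Hft) as [L [HL HLw]].
  destruct (locally_singleton _ _ HLw) as [EL Eg].
  assert (HdL := is_cderive_holomorphic L t HL).
  assert (Hdf' : is_cderive f t (C_derive L t * f t)%C).
  { rewrite <- EL. apply (is_cderive_ext_loc (fun w => Cexp (L w))).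
    - revert HLw; apply filter_imp; now intros w [-> _].
    - apply (is_cderive_comp Cexp L); [apply is_cderive_Cexp | exact HdL]. }
  rewrite (is_cderive_unique _ _ _ _ Hdf Hdf').
  apply (is_cderive_ext_loc (fun w => Cexp (RtoC e * L w))).
  { revert HLw; apply filter_imp; now intros w [_ ->]. }
  eapply is_cderive_eq.
  + apply (is_cderive_comp Cexp (fun w => (RtoC e * L w)%C));
      [apply is_cderive_Cexp | apply is_cderive_scal, HdL].
  + rewrite Eg. field; trivial.
Qed.

(** * Maximum modulus *)

Lemma continuous_pair_C {T : UniformSpace} (f g : T -> R) (x : T) :
  continuous f x -> continuous g x -> continuous (fun t => (f t, g t) : C) x.
Proof.
intros Hf Hg P [e HP]. unfold filtermap.
generalize (filter_and (F := locally x) (fun t => ball (f x) e (f t)) (fun t => ball (g x) e (g t))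
  (Hf _ (locally_ball (f x) e)) (Hg _ (locally_ball (g x) e))).
apply filter_imp. intros t [H1 H2]. apply HP; now split.
Qed.

Lemma continuous_Re {T : UniformSpace} (f : T -> C) (x : T) :
  continuous f x -> continuous (fun t => Re (f t)) x.
Proof. intros H; apply (continuous_comp f fst); [exact H | apply continuous_fst]. Qed.

Lemma continuous_Im {T : UniformSpace} (f : T -> C) (x : T) :
  continuous f x -> continuous (fun t => Im (f t)) x.
Proof. intros H; apply (continuous_comp f snd); [exact H | apply continuous_snd]. Qed.

Lemma continuous_Cplus {T : UniformSpace} (f g : T -> C) (x : T) :
  continuous f x -> continuous g x -> continuous (fun t => (f t + g t)%C) x.
Proof.
intros Hf Hg. apply continuous_pair_C.
- apply (continuous_plus (V := R_NormedModule) (fun t => Re (f t)) (fun t => Re (g t)));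
    now apply continuous_Re.
- apply (continuous_plus (V := R_NormedModule) (fun t => Im (f t)) (fun t => Im (g t)));
    now apply continuous_Im.
Qed.

Lemma continuous_Cmult {T : UniformSpace} (f g : T -> C) (x : T) :
  continuous f x -> continuous g x -> continuous (fun t => (f t * g t)%C) x.
Proof.
intros Hf Hg.
assert (H1 := continuous_Re f x Hf). assert (H2 := continuous_Im f x Hf).
assert (H3 := continuous_Re g x Hg). assert (H4 := continuous_Im g x Hg).
apply continuous_pair_C.
- apply (continuous_minus (V := R_NormedModule)
    (fun t => Re (f t) * Re (g t)) (fun t => Im (f t) * Im (g t)));
    now apply (continuous_mult (K := R_AbsRing)).
- apply (continuous_plus (V := R_NormedModule)
    (fun t => Re (f t) * Im (g t)) (fun t => Im (f t) * Re (g t)));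
    now apply (continuous_mult (K := R_AbsRing)).
Qed.

(** The curve [g] is described by the real derivatives of its coordinates, which suits circles
    written with [cos] and [sin]. *)
Lemma is_derive_Re_comp (f : C -> C) (g : R -> C) (s d1 d2 : R) (l : C) :
  is_cderive f (g s) l ->
  is_derive (fun u => Re (g u)) s d1 -> is_derive (fun u => Im (g u)) s d2 ->
  is_derive (fun u => Re (f (g u))) s (Re (l * (d1, d2))%C).
Proof.
intros Hf H1 H2. split; [apply (is_linear_scal_l (K := R_AbsRing) (V := R_NormedModule)) |].
intros x Hx eps. rewrite <- (is_filter_lim_locally_unique _ _ Hx). clear x Hx.
(* [K] serves both as a Lipschitz constant of [g] at [s], where the 2 covers the remainders of the
   two coordinates, and as a bound for [Cmod l]. *)
set (K := Cmod l + Rabs d1 + Rabs d2 + 2).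
assert (PK : 2 <= K)
  by (unfold K; generalize (Cmod_ge_0 l) (Rabs_pos d1) (Rabs_pos d2); lra).
(* The remainder of [f] contributes [e * K] and that of the curve [2 * e * K], hence the 3. *)
assert (Pe : 0 < Rmin 1 (eps / (3 * K))).
{ apply Rmin_pos; [lra |]. apply Rdiv_lt_0_compat; [apply cond_pos | lra]. }
set (e := mkposreal _ Pe).
destruct (proj1 (is_cderive_eps _ _ _) Hf e) as [df Hdf].
destruct (is_derive_eps _ _ _ H1 e) as [e1 He1].
destruct (is_derive_eps _ _ _ H2 e) as [e2 He2].
assert (Pd : 0 < Rmin (Rmin e1 e2) (df / K)).
{ repeat apply Rmin_pos; try apply cond_pos. apply Rdiv_lt_0_compat; [apply cond_pos | lra]. }
exists (mkposreal _ Pd). intros u Hu. change (Rabs (u - s) < Rmin (Rmin e1 e2) (df / K)) in Hu.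
assert (A1 := Rlt_le_trans _ _ _ Hu (Rmin_l _ _)).
assert (A2 := Rlt_le_trans _ _ _ Hu (Rmin_r _ _)).
assert (A3 := Rlt_le_trans _ _ _ A1 (Rmin_l _ _)).
assert (A4 := Rlt_le_trans _ _ _ A1 (Rmin_r _ _)).
specialize (He1 u A3). specialize (He2 u A4).
assert (Hle1 : pos e <= 1) by apply Rmin_l.
assert (HleK : pos e <= eps / (3 * K)) by apply Rmin_r.
set (h := u - s) in *. assert (Ph := Rabs_pos h).
set (r := ((g u - g s) - RtoC h * (d1, d2))%C).
assert (Hr : Cmod r <= 2 * (e * Rabs h)).
{ apply (Rle_trans _ _ _ (Cmod_le_Re_Im _)).
  replace (Re r) with (Re (g u) - Re (g s) - h * d1) by (unfold r, Re, Im; simpl; ring).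
  replace (Im r) with (Im (g u) - Im (g s) - h * d2) by (unfold r, Re, Im; simpl; ring).
  lra. }
assert (Hd : Cmod (d1, d2) <= Rabs d1 + Rabs d2) by apply Cmod_le_Re_Im.
assert (Hg : Cmod (g u - g s) <= K * Rabs h).
{ replace (g u - g s)%C with (r + RtoC h * (d1, d2))%C by (unfold r; ring).
  eapply Rle_trans; [apply Cmod_triangle |]. rewrite Cmod_mult, Cmod_R.
  assert (Rabs h * Cmod (d1, d2) <= Rabs h * (Rabs d1 + Rabs d2))
    by now apply Rmult_le_compat_l.
  assert (e * Rabs h <= 1 * Rabs h) by now apply Rmult_le_compat_r.
  assert (0 <= Cmod l * Rabs h) by (apply Rmult_le_pos; [apply Cmod_ge_0 | easy]).
  unfold K; lra. }
assert (Hlt : Cmod (g u - g s) < df).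
{ apply (Rle_lt_trans _ _ _ Hg). rewrite Rmult_comm. apply Rlt_div_r; lra. }
specialize (Hdf (g u) Hlt).
change (Rabs (Re (f (g u)) - Re (f (g s)) - h * Re (l * (d1, d2))%C) <= eps * Rabs h).
replace (Re (f (g u)) - Re (f (g s)) - h * Re (l * (d1, d2))%C)
  with (Re ((f (g u) - f (g s) - (g u - g s) * l) + r * l)%C)
  by (unfold r, Re, Im; simpl; ring).
apply (Rle_trans _ _ _ (re_le_Cmod _)).
eapply Rle_trans; [apply Cmod_triangle |]. rewrite Cmod_mult.
assert (B1 : e * Cmod (g u - g s) <= e * (K * Rabs h))
  by (apply Rmult_le_compat_l; [apply Rlt_le, cond_pos | easy]).
assert (B2 : Cmod r * Cmod l <= 2 * (e * Rabs h) * K).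
{ apply Rmult_le_compat; try apply Cmod_ge_0; trivial.
  unfold K. generalize (Rabs_pos d1) (Rabs_pos d2); lra. }
assert (B3 : e * (3 * K * Rabs h) <= eps / (3 * K) * (3 * K * Rabs h)).
{ apply Rmult_le_compat_r; trivial. apply Rmult_le_pos; lra. }
replace (eps / (3 * K) * (3 * K * Rabs h)) with (eps * Rabs h) in B3 by (field; lra).
lra.
Qed.

Lemma is_derive_Im_comp (f : C -> C) (g : R -> C) (s d1 d2 : R) (l : C) :
  is_cderive f (g s) l ->
  is_derive (fun u => Re (g u)) s d1 -> is_derive (fun u => Im (g u)) s d2 ->
  is_derive (fun u => Im (f (g u))) s (Im (l * (d1, d2))%C).
Proof.
intros Hf H1 H2.
apply (is_derive_ext (fun u => Re (- Ci * f (g u))%C)); [intros u; unfold Re, Im; simpl; ring |].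
replace (Im (l * (d1, d2))%C) with (Re (- Ci * l * (d1, d2))%C) by (unfold Re, Im; simpl; ring).
apply (is_derive_Re_comp (fun w => (- Ci * f w)%C)); trivial.
now apply is_cderive_scal.
Qed.

(** Nonnegativity makes the integral from [a] to every intermediate point vanish, so the primitive
    is constant near [x] and its derivative [h x] is 0. *)
Lemma RInt_nonneg_eq0 (h : R -> R) (a b x : R) :
  (forall y, continuous h y) -> (forall y, 0 <= h y) -> a < x < b ->
  RInt h a b = 0 -> h x = 0.
Proof.
intros Hc Hp Hx H0.
assert (Hex : forall u v, ex_RInt h u v)
  by (intros u v; apply (ex_RInt_continuous (V := R_CompleteNormedModule)); auto).
assert (Hz : forall y, a < y < b -> RInt h a y = 0).
{ intros y Hy.
  assert (E := RInt_Chasles (V := R_CompleteNormedModule) h a y b (Hex _ _) (Hex _ _)).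
  change plus with Rplus in E.
  assert (P1 := RInt_ge_0 h a y ltac:(lra) (Hex _ _) (fun u _ => Hp u)).
  assert (P2 := RInt_ge_0 h y b ltac:(lra) (Hex _ _) (fun u _ => Hp u)).
  lra. }
assert (D1 : is_derive (RInt h a) x (h x)).
{ apply (is_derive_RInt (V := R_NormedModule) h (RInt h a) a); [| apply Hc].
  apply filter_forall; intros y. apply (RInt_correct (V := R_CompleteNormedModule)), Hex. }
assert (D2 : is_derive (RInt h a) x 0).
{ apply (is_derive_ext_loc (fun _ => 0)); 
    [| apply (is_derive_const (K := R_AbsRing) (V := R_NormedModule))].
  assert (Hl : locally x (fun y => a < y /\ y < b))
    by (apply (filter_and (F := locally x)); [apply (open_gt a x) | apply (open_lt b x)]; lra).
  revert Hl; apply filter_imp; intros y Hy. symmetry; apply Hz; lra. }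
now rewrite <- (is_derive_unique _ _ _ D1), (is_derive_unique _ _ _ D2).
Qed.

(** The equations may be typed in a module structure carried by [R]; they are restated in [R] itself
    for [ring]. *)
Ltac ring_R := unfold Re, Im; simpl; match goal with |- @eq _ ?a ?b => change (@eq R a b) end; ring.

(** * Mean value property of real parts on circles *)

Section MeanValue.

Variables (f f' : C -> C) (z v : C) (d : R).
Hypothesis Hf : forall w, Cmod (w - z) < d -> is_cderive f w (f' w).
Hypothesis Hf' : forall w, Cmod (w - z) < d -> continuous f' w.

(** Polar coordinates around [z] with the vector [v] as unit: the circle s = 1 meets [z + v] at
    angle 0, an interior point of the interval from [- PI] to [PI]. *)
Definition ray (s t : R) : C := (z + RtoC s * (v * (cos t, sin t)))%C.

Lemma ray_in_disk (s t : R) : Rabs s * Cmod v < d -> Cmod (ray s t - z) < d.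
Proof.
intros H. unfold ray.
replace (z + RtoC s * (v * (cos t, sin t)) - z)%C with (RtoC s * (v * (cos t, sin t)))%C by ring.
rewrite !Cmod_mult, Cmod_R.
replace (Cmod (cos t, sin t)) with 1; [lra |].
unfold Cmod; simpl. rewrite !Rmult_1_r.
generalize (sin2_cos2 t); unfold Rsqr; intros E.
replace (cos t * cos t + sin t * sin t) with 1 by lra. now rewrite sqrt_1.
Qed.

Lemma ray_continuous (p : R * R) :
  continuous (fun q : R * R => ray (fst q) (snd q)) p.
Proof.
assert (Hs : continuous (fun q : R * R => RtoC (fst q)) p).
{ apply continuous_pair_C; [apply continuous_fst | apply continuous_const]. }
assert (Ht : continuous (fun q : R * R => (cos (snd q), sin (snd q)) : C) p).
{ apply continuous_pair_C.
  - apply (continuous_comp snd cos); [apply continuous_snd | apply continuous_cos].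
  - apply (continuous_comp snd sin); [apply continuous_snd | apply continuous_sin]. }
apply continuous_Cplus; [apply continuous_const |].
apply continuous_Cmult; [exact Hs |].
apply continuous_Cmult; [apply continuous_const | exact Ht].
Qed.

Lemma locally_radius (s : R) :
  Rabs s * Cmod v < d -> locally s (fun u => Rabs u * Cmod v < d).
Proof.
intros H. assert (Pv := Cmod_ge_0 v).
assert (Pd : 0 < (d - Rabs s * Cmod v) / (Cmod v + 1)) by (apply Rdiv_lt_0_compat; lra).
refine (ex_intro _ (mkposreal _ Pd) (fun (u : R) Hu => _)).
change (Rabs (u - s) < (d - Rabs s * Cmod v) / (Cmod v + 1)) in Hu.
apply Rlt_div_r in Hu; [| lra].
assert (T := Rabs_triang s (u - s)). replace (s + (u - s)) with u in T by ring.
assert (P := Rabs_pos (u - s)). nra.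
Qed.

Definition radial (s t : R) : R := Re (f' (ray s t) * (v * (cos t, sin t)))%C.

Lemma is_derive_radial (s t : R) :
  Rabs s * Cmod v < d -> is_derive (fun u => Re (f (ray u t))) s (radial s t).
Proof.
intros H. set (e := (v * (cos t, sin t))%C).
replace (radial s t) with (Re (f' (ray s t) * (Re e, Im e))%C)
  by (unfold radial; fold e; now destruct e).
apply is_derive_Re_comp.
- now apply Hf, ray_in_disk.
- apply (is_derive_ext (fun u => Re z + u * Re e)); [intros u; unfold ray; fold e; ring_R |].
  auto_derive; trivial; ring_R.
- apply (is_derive_ext (fun u => Im z + u * Im e)); [intros u; unfold ray; fold e; ring_R |].
  auto_derive; trivial; ring_R.
Qed.

(** Cauchy-Riemann in polar coordinates: the angular velocity of [ray] is i s times its radial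
    velocity, and the imaginary part of i w is the real part of w. *)
Lemma is_derive_angular (s t : R) :
  Rabs s * Cmod v < d -> is_derive (fun u => Im (f (ray s u))) t (s * radial s t).
Proof.
intros H.
replace (s * radial s t) with (Im (f' (ray s t) *
   ((s * (- Re v * sin t - Im v * cos t))%R, (s * (Re v * cos t - Im v * sin t))%R))%C)
  by (unfold radial, Re, Im; simpl; ring).
apply is_derive_Im_comp.
- now apply Hf, ray_in_disk.
- apply (is_derive_ext (fun u => Re z + s * (Re v * cos u - Im v * sin u)));
    [intros u; unfold ray; ring_R |].
  auto_derive; trivial; ring_R.
- apply (is_derive_ext (fun u => Im z + s * (Re v * sin u + Im v * cos u)));
    [intros u; unfold ray; ring_R |].
  auto_derive; trivial; ring_R.
Qed.

Lemma radial_continuous (s t : R) :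
  Rabs s * Cmod v < d -> continuous (fun q : R * R => radial (fst q) (snd q)) (s, t).
Proof.
intros H. apply continuous_Re, continuous_Cmult.
- apply (continuous_comp (fun q : R * R => ray (fst q) (snd q)) f').
  + apply ray_continuous.
  + now apply Hf', ray_in_disk.
- apply continuous_Cmult; [apply continuous_const |].
  apply continuous_pair_C.
  + apply (continuous_comp snd cos); [apply continuous_snd | apply continuous_cos].
  + apply (continuous_comp snd sin); [apply continuous_snd | apply continuous_sin].
Qed.

Lemma continuous_section {V : UniformSpace} (g : R * R -> V) (s t : R) :
  continuous g (s, t) -> continuous (fun u => g (s, u)) t.
Proof.
intros H. apply (continuous_comp (fun u => (s, u)) g); trivial.
intros P [e HP]. exists e; intros u Hu. apply HP; split; [apply ball_center | exact Hu].
Qed.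

(* [s * radial s] is the derivative of the [2 * PI]-periodic function [Im (f (ray s t))] of [t]. *)
Lemma RInt_radial (s : R) :
  Rabs s * Cmod v < d -> s <> 0 -> RInt (radial s) (- PI) PI = 0.
Proof.
intros H Hs.
assert (Hc : forall t, continuous (radial s) t)
  by (intros t; exact (continuous_section _ s t (radial_continuous s t H))).
assert (E : is_RInt (fun t => s * radial s t) (- PI) PI
  (minus (Im (f (ray s PI))) (Im (f (ray s (- PI)))))).
{ apply (is_RInt_derive (V := R_CompleteNormedModule) (fun u => Im (f (ray s u)))).
  - intros t _. now apply is_derive_angular.
  - intros t _. apply (continuous_scal_r (K := R_AbsRing) (V := R_NormedModule)), Hc. }
replace (ray s (- PI)) with (ray s PI) in E
  by (unfold ray; now rewrite cos_neg, sin_neg, sin_PI, Ropp_0).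
assert (E1 : is_RInt (fun t => s * radial s t) (- PI) PI (s * RInt (radial s) (- PI) PI)).
{ apply (is_RInt_scal (V := R_NormedModule)), (RInt_correct (V := R_CompleteNormedModule)).
  apply (ex_RInt_continuous (V := R_CompleteNormedModule)); auto. }
apply (is_RInt_unique (V := R_CompleteNormedModule)) in E.
apply (is_RInt_unique (V := R_CompleteNormedModule)) in E1.
rewrite E in E1. change minus with Rminus in E1.
apply (Rmult_eq_reg_l s); trivial. rewrite <- E1.
change (@minus R_CompleteNormedModule) with Rminus. ring_R.
Qed.

Lemma continuous_on_circle (s t : R) :
  Rabs s * Cmod v < d -> continuous (fun u => Re (f (ray s u))) t.
Proof.
intros H. apply (continuous_section (fun q : R * R => Re (f (ray (fst q) (snd q))))).
apply continuous_Re, (continuous_comp (fun q : R * R => ray (fst q) (snd q)) f).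
- apply ray_continuous.
- now apply (is_cderive_continuous _ _ (f' (ray s t))), Hf, ray_in_disk.
Qed.

(** The circle integral has derivative 0 in the scale [s] by [RInt_radial], and at scale 0 its
    integrand is the constant [Re (f z)]. *)
Lemma mean_value_property :
  Cmod v < d -> RInt (fun t => Re (f (ray 1 t))) (- PI) PI = 2 * PI * Re (f z).
Proof.
intros Hv. assert (Pv := Cmod_ge_0 v).
set (I := fun s => RInt (fun t => Re (f (ray s t))) (- PI) PI).
assert (HI : forall s, Rabs s * Cmod v < d ->
  is_derive I s (RInt (fun t => Derive (fun u => Re (f (ray u t))) s) (- PI) PI)).
{ intros s Hs. apply (is_derive_RInt_param (fun s t => Re (f (ray s t)))).
  - generalize (locally_radius s Hs). apply filter_imp; intros u Hu t _.
    exists (radial u t). now apply is_derive_radial.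
  - intros t _. apply (continuity_2d_pt_ext_loc radial).
    + apply locally_2d_locally.
      assert (H1 : continuous (fst : R * R -> R) (s, t)) by apply continuous_fst.
      assert (H2 := H1 _ (locally_radius s Hs)). unfold filtermap in H2.
      revert H2; apply filter_imp; intros [u w] Hu; simpl in *.
      symmetry; apply is_derive_unique. now apply is_derive_radial.
    + apply continuity_2d_pt_filterlim. now apply radial_continuous.
  - generalize (locally_radius s Hs). apply filter_imp; intros u Hu.
    apply (ex_RInt_continuous (V := R_CompleteNormedModule)).
    intros t _. now apply continuous_on_circle. }
assert (H01 : forall s, 0 <= s <= 1 -> Rabs s * Cmod v < d).
{ intros s Hs. rewrite Rabs_right by lra. nra. }
(* The mean value theorem asks for the derivative on the open interval, away from the scale 0 that
   [RInt_radial] excludes, and for continuity on the closed one. *)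
destruct (MVT_gen I 0 1 (fun _ => 0)) as [c [_ Hc]].
- rewrite Rmin_left, Rmax_right by lra. intros s Hs.
  assert (Hs' : Rabs s * Cmod v < d) by (apply H01; lra).
  rewrite <- (RInt_radial s Hs' ltac:(lra)).
  rewrite (RInt_ext (V := R_CompleteNormedModule) (radial s)
    (fun t => Derive (fun u => Re (f (ray u t))) s)); [now apply HI |].
  intros t _. symmetry; apply is_derive_unique. now apply is_derive_radial.
- rewrite Rmin_left, Rmax_right by lra. intros s Hs.
  apply continuity_pt_filterlim.
  apply (ex_derive_continuous (K := R_AbsRing) (V := R_NormedModule) I s).
  eexists. apply HI, H01, Hs.
- assert (E0 : I 0 = 2 * PI * Re (f z)).
  { unfold I. rewrite (RInt_ext (V := R_CompleteNormedModule) _ (fun _ => Re (f z))).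
    - rewrite RInt_const.
      change (scal (PI - - PI) (Re (f z))) with ((PI - - PI) * Re (f z)). ring_R.
    - intros t _. unfold ray. now rewrite Cmult_0_l, Cplus_0_r. }
  fold (I 1). lra.
Qed.

(** The gap between the value at the centre and the values on the circle is nonnegative with
    integral 0, so it vanishes at angle 0. *)
Lemma Re_maximum_on_disk :
  (forall w, Cmod (w - z) < d -> Re (f w) <= Re (f z)) -> Cmod v < d ->
  Re (f (z + v)%C) = Re (f z).
Proof.
intros Hmax Hv.
assert (H1 : forall t, Cmod (ray 1 t - z) < d)
  by (intros t; apply ray_in_disk; rewrite Rabs_R1; lra).
assert (Hc : forall t, continuous (fun t => Re (f (ray 1 t))) t)
  by (intros t; apply continuous_on_circle; rewrite Rabs_R1; lra).
assert (E : Re (f z) - Re (f (ray 1 0)) = 0).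
{ apply (RInt_nonneg_eq0 (fun t => Re (f z) - Re (f (ray 1 t))) (- PI) PI 0).
  - intros t. apply (continuous_minus (V := R_NormedModule)); [apply continuous_const | apply Hc].
  - intros t. specialize (Hmax _ (H1 t)). lra.
  - generalize PI_RGT_0; lra.
  - rewrite (RInt_minus (V := R_CompleteNormedModule) (fun _ => Re (f z))).
    + rewrite RInt_const, mean_value_property by trivial.
      change (scal (PI - - PI) (Re (f z))) with ((PI - - PI) * Re (f z)).
      change (@minus R_CompleteNormedModule) with Rminus. ring_R.
    + apply (ex_RInt_const (V := R_NormedModule)).
    + apply (ex_RInt_continuous (V := R_CompleteNormedModule)); auto. }
replace (z + v)%C with (ray 1 0); [lra |].
unfold ray. rewrite cos_0, sin_0. destruct z, v. apply injective_projections; simpl; ring.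
Qed.

End MeanValue.

(** Dividing by a nonzero [f z] gives a function g with |g| <= 1 and g(z) = 1. Its real part is
    maximal at [z], hence constantly 1, and |g| <= 1 then forces the imaginary part to be 0. *)
Lemma maximum_modulus (f f' : C -> C) (z : C) :
  locally z (fun w => is_cderive f w (f' w)) -> locally z (continuous f') ->
  locally z (fun w => Cmod (f w) <= Cmod (f z)) -> locally z (fun w => f w = f z).
Proof.
intros Hf Hf' Hmax.
destruct (classic (f z = 0%C)) as [Hz | Hz].
{ revert Hmax; apply filter_imp; intros w Hw. rewrite Hz in *.
  apply Cmod_eq_0. rewrite Cmod_0 in Hw. generalize (Cmod_ge_0 (f w)); lra. }
destruct (proj1 (locally_Cmod _ _) (filter_and _ _ Hf (filter_and _ _ Hf' Hmax))) as [d Hd].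
apply locally_Cmod; exists d; intros w Hw.
set (g := fun u => (/ f z * f u)%C).
assert (Hgz : g z = 1%C) by (unfold g; field; trivial).
assert (Hg1 : forall u, Cmod (u - z) < d -> Cmod (g u) <= 1).
{ intros u Hu. destruct (Hd u Hu) as [_ [_ H]]. unfold g.
  rewrite Cmod_mult, Cmod_inv by trivial.
  rewrite Rmult_comm. apply Rle_div_l; [now apply Cmod_gt_0 | lra]. }
assert (E : Re (g w) = 1).
{ replace w with (z + (w - z))%C by ring.
  rewrite (Re_maximum_on_disk g (fun u => (/ f z * f' u)%C) z (w - z) d); trivial.
  - now rewrite Hgz.
  - intros u Hu. apply is_cderive_scal. now apply Hd.
  - intros u Hu. apply continuous_Cmult; [apply continuous_const | now apply Hd].
  - intros u Hu. rewrite Hgz. specialize (Hg1 u Hu).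
    assert (A := re_le_Cmod (g u)). assert (B := Rle_abs (Re (g u))). change (Re 1) with 1. lra. }
assert (E2 : g w = 1%C).
{ specialize (Hg1 w Hw). assert (H2 := Cmod2_alt (g w)). assert (P := Cmod_ge_0 (g w)).
  assert (Hq : forall x y : R, x ^ 2 = 1 ^ 2 + y ^ 2 -> 0 <= x <= 1 -> y = 0)
    by (intros x y Hxy Hx; apply Rsqr_0_uniq; unfold Rsqr; nra).
  rewrite E in H2. assert (HI := Hq _ _ H2 (conj P Hg1)).
  destruct (g w) as [x y]; simpl in E, HI; now subst. }
unfold g in E2. replace (f w) with (f z * (/ f z * f w))%C by (field; trivial).
rewrite E2; ring.
Qed.

(** * Differentiating the series representation *)

(** The second alternative makes no claim about the differentiated series, which may diverge when
    [X] is locally constant with value on the circle of convergence. *)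
Lemma power_series_comp_derive (A : nat -> C) (X X' S : C -> C) (t : C) :
  locally t (fun w => is_cderive X w (X' w)) -> locally t (continuous X') ->
  locally t (fun w => is_cseries (fun j => (A j * X w ^ j)%C) (S w)) ->
  (exists F1 : C, is_cseries (fun j => (RtoC (INR j) * A j * X t ^ pred j)%C) F1 /\
     is_cderive S t (X' t * F1)%C) \/
  (X' t = 0%C /\ is_cderive S t (RtoC 0)).
Proof.
intros HX HX' HS.
destruct (classic (locally t (fun w => Cmod (X w) <= Cmod (X t)))) as [Hmax | Hmax].
- right. assert (Hcst := maximum_modulus X X' t HX HX' Hmax). split.
  + apply (is_cderive_unique X t); [exact (locally_singleton _ _ HX) |].
    apply (is_cderive_ext_loc (fun _ => X t)); [| apply is_cderive_const].
    revert Hcst; apply filter_imp; now intros w ->.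
  + apply (is_cderive_ext_loc (fun _ => S t)); [| apply is_cderive_const].
    generalize (filter_and _ _ Hcst HS); apply filter_imp; intros w [Ew Hw].
    rewrite Ew in Hw.
    exact (is_cseries_unique _ _ _ (locally_singleton _ _ HS) Hw).
- left. destruct (proj1 (locally_Cmod _ _) HS) as [d Hd].
  (* The series converges at [X w] for every [w] in this disk, so a larger [Cmod (X w)] supplies a
     point of convergence beyond [X t]. *)
  assert (Hw : exists w, Cmod (w - t) < d /\ Cmod (X t) < Cmod (X w)).
  { apply NNPP; intros Hno. apply Hmax, locally_Cmod; exists d; intros w Hw.
    apply Rnot_lt_le; intros Hlt. apply Hno; now exists w. }
  destruct Hw as [w1 [Hw1 Hlt]].
  destruct (power_series_derive A (X t) (X w1) (S w1) (Hd w1 Hw1) Hlt)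
    as [F [F1 [HF [HF1 HdF]]]].
  exists F1; split; [exact HF1 |].
  (* [F (X w)] and [S w] sum the same series once [w] is close enough to [t] for [X w] to lie in the
     disk of [F]. *)
  apply (is_cderive_ext_loc (fun w => F (X w))).
  + assert (Hc := is_cderive_continuous _ _ _ (locally_singleton _ _ HX)).
    assert (Hn : locally t (fun w => Cmod (X w) < Cmod (X w1))).
    { apply (Hc (fun x => Cmod x < Cmod (X w1))).
      apply (proj2 (locally_Cmod (X t) _)).
      assert (Pd : 0 < Cmod (X w1) - Cmod (X t)) by lra.
      exists (mkposreal _ Pd); simpl; intros x Hx.
      assert (T := Cmod_triangle (X t) (x - X t)).
      replace (X t + (x - X t))%C with x in T by ring. lra. }
    generalize (filter_and _ _ Hn HS); apply filter_imp; intros w [Hw HSw].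
    exact (is_cseries_unique _ _ _ (HF _ Hw) HSw).
  + apply is_cderive_comp; [exact HdF | exact (locally_singleton _ _ HX)].
Qed.

Lemma two_pi_i_neq_0 : (2 * RtoC PI * Ci)%C <> 0%C.
Proof.
repeat apply Cmult_neq_0.
- intros H; injection H; lra.
- intros H; injection H; apply PI_neq0.
- exact Ci_nz.
Qed.

(** The factor [U t] is kept inside the series of [s1]: if X' vanishes at [t], then so does U X
    because [Z t] is nonzero, and every term of that series is 0 even where the series of j A_j X^j
    might diverge. *)
Lemma derive_of_series_representation
  (Z X U : C -> C) (D : C -> Prop) (e0 e1 : R) (Xe0 Xe1 : C -> C) (A : nat -> C) (t : C) :
  open D -> D t ->
  (forall w, D w -> holomorphic_at X w -> holomorphic_at U w -> holomorphic_at Z w ->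
     C_derive X w = (2 * RtoC PI * Ci * (U w * X w * Z w))%C) ->
  holomorphic_power D X e0 Xe0 ->
  holomorphic_power D (fun w => (1 - X w)%C) e1 Xe1 ->
  (forall w, D w -> holomorphic_at X w -> holomorphic_at Z w ->
     exists s : C, is_cseries (fun j => (A j * X w ^ j)%C) s /\
       Z w = (Xe0 w * Xe1 w * s)%C) ->
  holomorphic_at X t -> holomorphic_at U t -> holomorphic_at Z t ->
  Z t <> 0%C -> (e1 <> 0 -> X t <> 1%C) ->
  exists s0 s1 : C,
    is_cseries (fun j => (A j * X t ^ j)%C) s0 /\
    is_cseries (fun j => (U t * RtoC (INR j) * A j * X t ^ j)%C) s1 /\
    Z t = (Xe0 t * Xe1 t * s0)%C /\
    C_derive Z t = (2 * RtoC PI * Ci * Z t * (Xe0 t * Xe1 t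
      * (s1 + U t * (RtoC e0 + RtoC e1 * (X t / (X t - 1))) * s0)))%C.
Proof.
intros HD Dt Hode H0 H1 Hser HX HU HZ HZ0 HX1.
assert (Hnear : locally t (fun w => D w /\ holomorphic_at X w /\ holomorphic_at U w /\
  holomorphic_at Z w)).
{ apply filter_and; [now apply HD |].
  apply filter_and; [now apply locally_holomorphic_at |].
  apply filter_and; now apply locally_holomorphic_at. }
(* The sums are gathered into a function [G] that can be differentiated at [t], with default 0 where
   the representation is not given. *)
destruct (functional_choice (fun w s =>
  D w /\ holomorphic_at X w /\ holomorphic_at Z w ->
  is_cseries (fun j => (A j * X w ^ j)%C) s /\ Z w = (Xe0 w * Xe1 w * s)%C)) as [G HG].
{ intros w. destruct (classic (D w /\ holomorphic_at X w /\ holomorphic_at Z w))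
    as [[Hw1 [Hw2 Hw3]] | Hn].
  - destruct (Hser w Hw1 Hw2 Hw3) as [s Hs]. now exists s.
  - exists (RtoC 0). tauto. }
assert (HGt := HG t (conj Dt (conj HX HZ))). destruct HGt as [HGt EZ].
set (X' := fun w => (2 * RtoC PI * Ci * (U w * X w * Z w))%C).
assert (HX' : is_cderive X t (X' t)).
{ unfold X'. rewrite <- Hode by trivial. now apply is_cderive_holomorphic. }
assert (P0 : Xe0 t <> 0%C /\ Xe1 t <> 0%C).
{ split; intros E; apply HZ0; rewrite EZ, E; ring. }
destruct P0 as [P0 P1].
(* A zero of [X] with positive exponent would annihilate [Xe0 t] and hence [Z t]. *)
assert (He0 : X t <> 0%C \/ e0 = 0).
{ destruct (classic (X t = 0%C)) as [E | E]; [right | now left].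
  destruct (H0 t Dt HX) as [_ [_ Hz]]. destruct (Hz E) as [[He _] | [_ E0]]; tauto. }
assert (He1 : (1 - X t)%C <> 0%C \/ e1 = 0).
{ destruct (classic (e1 = 0)) as [E | E]; [now right | left].
  intros E1. apply (HX1 E). replace (X t) with (1 - (1 - X t))%C by ring. rewrite E1; ring. }
assert (H1X : holomorphic_at (fun w => (1 - X w)%C) t).
{ unfold holomorphic_at in HX |- *. revert HX; apply filter_imp; intros w [l Hl].
  eexists. apply is_cderive_plus; [apply is_cderive_const | apply is_cderive_opp, Hl]. }
assert (HdX1 : is_cderive (fun w => (1 - X w)%C) t (- X' t)%C).
{ eapply is_cderive_eq.
  - apply is_cderive_plus; [apply is_cderive_const | apply is_cderive_opp, HX'].
  - ring. }
assert (D0 := holomorphic_power_derive D X Xe0 e0 t _ HD H0 Dt HX HX' He0).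
assert (D1 := holomorphic_power_derive D _ Xe1 e1 t _ HD H1 Dt H1X HdX1 He1).
assert (DZ : forall G', is_cderive G t G' -> C_derive Z t =
  (Xe0 t * Xe1 t * G' + (RtoC e0 * (X' t / X t) + RtoC e1 * (- X' t / (1 - X t))) * Z t)%C).
{ intros G' HG'. apply is_C_derive_unique.
  apply (is_cderive_ext_loc (fun w => (Xe0 w * Xe1 w * G w)%C)).
  - revert Hnear; apply filter_imp; intros w [Hw1 [Hw2 [_ Hw3]]].
    symmetry; now apply HG.
  - eapply is_cderive_eq; [apply is_cderive_mult; [apply is_cderive_mult |]; eassumption |].
    cbv beta. rewrite EZ. ring. }
assert (Hlog : (RtoC e0 * (X' t / X t) + RtoC e1 * (- X' t / (1 - X t)))%C
  = (2 * RtoC PI * Ci * U t * Z t * (RtoC e0 + RtoC e1 * (X t / (X t - 1))))%C).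
(* An exponent 0 is treated apart, since its quotient may have a zero denominator. *)
{ assert (E0 : (RtoC e0 * (X' t / X t))%C = (2 * RtoC PI * Ci * U t * Z t * RtoC e0)%C).
  { destruct He0 as [He0 | ->]; [unfold X'; field; trivial | ring]. }
  assert (E1 : (RtoC e1 * (- X' t / (1 - X t)))%C
    = (2 * RtoC PI * Ci * U t * Z t * (RtoC e1 * (X t / (X t - 1))))%C).
  { destruct He1 as [He1 | ->]; [unfold X'; field | ring].
    split; trivial. intros E; apply He1. rewrite <- Copp_minus_distr, E; ring. }
  rewrite E0, E1; ring. }
destruct (power_series_comp_derive A X X' G t) as [[F1 [HF1 HdG]] | [HX0 HdG]].
- revert Hnear; apply filter_imp; intros w [Hw1 [Hw2 [Hw3 Hw4]]].
  unfold X'. rewrite <- Hode by trivial. now apply is_cderive_holomorphic.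
- revert Hnear; apply filter_imp; intros w [Hw1 [Hw2 [Hw3 Hw4]]].
  apply continuous_Cmult; [apply continuous_const |].
  repeat apply continuous_Cmult; now apply holomorphic_at_continuous.
- revert Hnear; apply filter_imp; intros w [Hw1 [Hw2 [_ Hw3]]]. now apply HG.
- exists (G t), (U t * X t * F1)%C; repeat split; trivial.
  + apply (is_series_ext (K := C_AbsRing) (V := C_NormedModule)
      (fun j => (U t * X t * (RtoC (INR j) * A j * X t ^ pred j))%C)).
    * intros [|j]; apply injective_projections; simpl; ring.
    * now apply (is_series_scal (K := C_AbsRing) (V := C_NormedModule)).
  + rewrite (DZ _ HdG), Hlog. unfold X'. rewrite EZ. ring.
- exists (G t), (RtoC 0).
  assert (HUX : (U t * X t)%C = 0%C).
  { apply NNPP; intros Hn.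
    apply (Cmult_neq_0 _ _ two_pi_i_neq_0 (Cmult_neq_0 _ _ Hn HZ0)), HX0. }
  repeat split; trivial.
  + apply is_cseries_0. intros [|j]; [simpl; ring |].
    transitivity ((U t * X t) * (RtoC (INR (S j)) * A (S j) * X t ^ j))%C;
      [simpl | rewrite HUX]; ring.
  + rewrite (DZ _ HdG), Hlog. rewrite EZ. ring.
Qed.

(** * Removing singularities with the slash action *)

Lemma exists_punctured (z : C) (P : C -> Prop) :
  locally' z P -> exists w, w <> z /\ P w.
Proof.
intros H. destruct (proj1 (locally_Cmod z _) H) as [d Hd].
assert (Pd := cond_pos d).
assert (Hw : (z + RtoC (d / 2))%C <> z).
{ intros E. assert (E1 : RtoC (d / 2) = RtoC 0).
  { replace (RtoC (d / 2)) with (z + RtoC (d / 2) - z)%C by ring. rewrite E; ring. }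
  injection E1; lra. }
exists (z + RtoC (d / 2))%C; split; trivial. apply Hd; trivial.
replace (z + RtoC (d / 2) - z)%C with (RtoC (d / 2)) by ring.
rewrite Cmod_R, Rabs_right; lra.
Qed.

Lemma continuous_neq (f : C -> C) (z v : C) :
  continuous f z -> f z <> v -> locally z (fun w => f w <> v).
Proof.
intros Hc Hv.
assert (P : 0 < Cmod (f z - v)).
{ apply Cmod_gt_0. intros E. apply Hv.
  replace (f z) with (f z - v + v)%C by ring. rewrite E; ring. }
apply (Hc (fun u => u <> v)). apply (proj2 (locally_Cmod (f z) _)).
exists (mkposreal _ P); simpl; intros w Hw ->.
rewrite <- Cmod_opp in Hw. replace (- (v - f z))%C with (f z - v)%C in Hw by ring. lra.
Qed.

Lemma meromorphic_punctured (f : C -> C) (z : C) :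
  holomorphic_at f z \/ pole_at f z -> locally' z (holomorphic_at f).
Proof.
unfold locally', within. intros [H | [H _]].
- generalize (locally_holomorphic_at f z H). apply filter_imp; auto.
- generalize (locally_locally _ _ H). apply filter_imp; intros w Hw Hne.
  (* A point other than [z] has a neighbourhood avoiding [z], which turns differentiability off [z]
     into [holomorphic_at]. *)
  assert (Hn := continuous_neq (fun u => u) w z (continuous_id w) Hne).
  unfold holomorphic_at. generalize (filter_and _ _ Hn Hw).
  apply filter_imp; intros u [H1 H2]; auto.
Qed.

(** Near a pole [Cmod (f w)] exceeds every bound, whereas here it follows the bounded [Cmod (g w)].
    The dichotomy in the first hypothesis excludes removable singularities. *)
Lemma holomorphic_at_of_punctured_eq (f g : C -> C) (z : C) :
  holomorphic_at f z \/ pole_at f z -> continuous g z ->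
  locally' z (fun w => f w = g w) -> holomorphic_at f z.
Proof.
intros [H | [_ Hinf]] Hg Hfg; trivial. exfalso.
assert (Hbig : locally' z (fun w => Cmod (g z) + 1 < Cmod (f w))).
{ apply (Hinf (fun x => Cmod (g z) + 1 < x)). now exists (Cmod (g z) + 1). }
assert (Hsmall : locally z (fun w => Cmod (g w) < Cmod (g z) + 1)).
{ apply (Hg (fun u => Cmod u < Cmod (g z) + 1)).
  apply (proj2 (locally_Cmod (g z) _)). exists (mkposreal 1 Rlt_0_1); simpl; intros u Hu.
  assert (T := Cmod_triangle (g z) (u - g z)).
  replace (g z + (u - g z))%C with u in T by ring. lra. }
destruct (exists_punctured z (fun w => f w = g w /\ Cmod (g z) + 1 < Cmod (f w) /\
  Cmod (g w) < Cmod (g z) + 1)) as [w [_ [E [H1 H2]]]].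
- unfold locally', within in *.
  generalize (filter_and _ _ Hfg (filter_and _ _ Hbig Hsmall)).
  apply filter_imp; intros w [H1 [H2 H3]] Hw; auto.
- rewrite E in H1; lra.
Qed.

Lemma locally_upper_half_plane (t : C) :
  upper_half_plane t -> locally t upper_half_plane.
Proof.
intros H. apply (continuous_Im (fun w => w) t (continuous_id t) (fun y => 0 < y)).
now apply open_gt.
Qed.

(** Trace 0 and determinant 1 give b c = - 1 - a^2, so the square of the matrix is minus the
    identity, which acts trivially. *)
Lemma mobius_involution (a b c : R) (t : C) :
  in_SL2 (Mat2 a b c (- a)) -> automorphy (Mat2 a b c (- a)) t <> 0%C ->
  let s := mobius (Mat2 a b c (- a)) t in
  automorphy (Mat2 a b c (- a)) s = (- / automorphy (Mat2 a b c (- a)) t)%C /\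
  mobius (Mat2 a b c (- a)) s = t.
Proof.
unfold in_SL2, mobius, automorphy; simpl. intros Hdet Ht.
assert (E : (RtoC b * RtoC c)%C = (- (1) - RtoC a * RtoC a)%C).
{ rewrite <- !RtoC_mult, <- RtoC_opp, <- RtoC_minus. f_equal. lra. }
rewrite RtoC_opp in *.
assert (E1 : (RtoC c * ((RtoC a * t + RtoC b) / (RtoC c * t + - RtoC a)) + - RtoC a)%C
  = (- / (RtoC c * t + - RtoC a))%C).
{ transitivity ((RtoC b * RtoC c + RtoC a * RtoC a) / (RtoC c * t + - RtoC a))%C;
    [| rewrite E]; field; trivial. }
split; [exact E1 |]. rewrite E1.
transitivity (- (RtoC a * RtoC a + RtoC b * RtoC c) * t)%C; [field; trivial | rewrite E; ring].
Qed.

Lemma is_cderive_automorphy (M : mat2) (t : C) :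
  is_cderive (automorphy M) t (RtoC (m21 M)).
Proof.
eapply is_cderive_eq.
- apply is_cderive_plus; [apply is_cderive_scal, is_cderive_id | apply is_cderive_const].
- ring.
Qed.

Lemma is_cderive_mobius (M : mat2) (t : C) :
  in_SL2 M -> automorphy M t <> 0%C ->
  is_cderive (mobius M) t (/ (automorphy M t * automorphy M t))%C.
Proof.
intros Hdet Ht. unfold in_SL2 in Hdet.
eapply is_cderive_eq.
- apply (is_cderive_div (fun t => RtoC (m11 M) * t + RtoC (m12 M))%C (automorphy M));
    [| apply is_cderive_automorphy | exact Ht].
  apply is_cderive_plus; [apply is_cderive_scal, is_cderive_id | apply is_cderive_const].
- cbv beta. replace (/ (automorphy M t * automorphy M t))%C
    with ((RtoC (m11 M * m22 M - m12 M * m21 M)) / (automorphy M t * automorphy M t))%C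
    by (rewrite Hdet; field; trivial).
  rewrite RtoC_minus, !RtoC_mult. unfold automorphy in *. field. trivial.
Qed.

Lemma slash_eigen_mul (k : nat) (f : C -> C) (M : mat2) (lambda t : C) :
  slash_eigen k f M lambda -> upper_half_plane t -> automorphy M t <> 0%C ->
  holomorphic_at f t -> holomorphic_at f (mobius M t) ->
  f (mobius M t) = (lambda * automorphy M t ^ k * f t)%C.
Proof.
intros H Ht Ha H1 H2. specialize (H t Ht H1 H2). unfold slash in H.
assert (Hk := Cpow_nz (automorphy M t) k Ha).
transitivity (automorphy M t ^ k * (/ automorphy M t ^ k * f (mobius M t)))%C;
  [field; trivial | rewrite H; ring].
Qed.

(** [slash_eigen] speaks only where [Z] is holomorphic at both points, so it cannot be
    differentiated at [t0] before holomorphy at the image point is established. *)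
Lemma slash_eigen_involution (Z : C -> C) (k : nat) (a b c : R) (alpha t0 : C) :
  let g := Mat2 a b c (- a) in
  in_SL2 g -> meromorphic_on upper_half_plane Z -> slash_eigen k Z g alpha ->
  upper_half_plane t0 -> upper_half_plane (mobius g t0) -> automorphy g t0 <> 0%C ->
  holomorphic_at Z t0 -> Z t0 <> 0%C ->
  holomorphic_at Z (mobius g t0) /\ Z (mobius g t0) <> 0%C /\
  locally t0 (fun t => Z (mobius g t) = (alpha * automorphy g t ^ k * Z t)%C).
Proof.
intros g Hg HZ Ha Ht0 Ht1 Hj HZ0 Hz0.
set (t1 := mobius g t0) in *.
destruct (mobius_involution a b c t0 Hg Hj) as [E1 E2]. fold g in E1, E2. fold t1 in E1, E2.
assert (Hj1 : automorphy g t1 <> 0%C).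
{ rewrite E1. intros E. apply C1_nz.
  transitivity (- (- / automorphy g t0) * automorphy g t0)%C; [field; trivial | rewrite E; ring]. }
assert (Cj : forall t, continuous (automorphy g) t)
  by (intros t; exact (is_cderive_continuous _ _ _ (is_cderive_automorphy g t))).
assert (Cm : forall t, automorphy g t <> 0%C -> continuous (mobius g) t)
  by (intros t Ht; exact (is_cderive_continuous _ _ _ (is_cderive_mobius g t Hg Ht))).
(* Since [g] is an involution, the slash equation at [mobius g t] bounds [Z t] near [t1]. *)
assert (HZ1 : holomorphic_at Z t1).
{ apply (holomorphic_at_of_punctured_eq Z
    (fun t => (alpha * automorphy g (mobius g t) ^ k * Z (mobius g t))%C)).
  - now apply HZ.
  - apply continuous_Cmult; [apply continuous_Cmult; [apply continuous_const |] |].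
    + apply (continuous_comp (mobius g) (fun s => (automorphy g s ^ k)%C)); [now apply Cm |].
      exact (is_cderive_continuous _ _ _
        (is_cderive_pow (automorphy g) _ _ k (is_cderive_automorphy g _))).
    + apply (continuous_comp (mobius g) Z); [now apply Cm |].
      rewrite E2. now apply holomorphic_at_continuous.
  - assert (Hp := meromorphic_punctured Z t1 (HZ t1 Ht1)).
    assert (Hn : locally t0 (fun s => upper_half_plane s /\ holomorphic_at Z s /\
      automorphy g s <> 0%C)).
    { apply filter_and; [now apply locally_upper_half_plane |].
      apply filter_and; [now apply locally_holomorphic_at | now apply continuous_neq]. }
    (* Read as a neighbourhood of [mobius g t1], it is pulled back to [t1] by continuity. *)
    rewrite <- E2 in Hn.
    assert (Hn1 := Cm t1 Hj1 _ Hn). unfold filtermap in Hn1.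
    assert (Hn2 := continuous_neq _ _ _ (Cj t1) Hj1).
    unfold locally', within in *.
    generalize (filter_and _ _ Hp (filter_and _ _ Hn1 Hn2)).
    apply filter_imp; intros t [A1 [[A2 [A3 A4]] A5]] Hne.
    destruct (mobius_involution a b c t Hg A5) as [_ E3]. fold g in E3.
    assert (S := slash_eigen_mul k Z g alpha (mobius g t) Ha A2 A4 A3).
    rewrite E3 in S. apply S; auto. }
split; [exact HZ1 |].
split.
(* The equation at [t1] expresses [Z t0] as a multiple of [Z t1]. *)
- intros Hz1. apply Hz0.
  assert (S := slash_eigen_mul k Z g alpha t1 Ha Ht1 Hj1 HZ1).
  rewrite E2 in S. rewrite (S HZ0), Hz1; ring.
- assert (Hn1 := Cm t0 Hj _ (locally_holomorphic_at _ _ HZ1)). unfold filtermap in Hn1.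
  generalize (filter_and _ _ (filter_and _ _ (locally_upper_half_plane t0 Ht0)
    (continuous_neq _ _ _ (Cj t0) Hj)) (filter_and _ _ (locally_holomorphic_at _ _ HZ0) Hn1)).
  apply filter_imp; intros t [[A1 A2] [A3 A4]]. now apply slash_eigen_mul.
Qed.

(** Applied with N tau0 as [t0] and tau1 as its translate. Holomorphy is known at the translate and
    has to be carried back, by dividing by [beta]. *)
Lemma slash_eigen_translation (Z : C -> C) (k : nat) (h : R) (beta t0 : C) :
  meromorphic_on upper_half_plane Z -> slash_eigen k Z (Mat2 1 h 0 1) beta ->
  upper_half_plane t0 -> holomorphic_at Z (t0 + RtoC h)%C -> Z (t0 + RtoC h)%C <> 0%C ->
  beta <> 0%C /\ locally t0 (fun t => Z (t + RtoC h)%C = (beta * Z t)%C).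
Proof.
intros HZ Hb Ht0 HZ1 Hz1.
assert (Hj : forall t, automorphy (Mat2 1 h 0 1) t = RtoC 1)
  by (intros t; unfold automorphy; simpl; ring).
assert (Hm : forall t, mobius (Mat2 1 h 0 1) t = (t + RtoC h)%C)
  by (intros t; unfold mobius; rewrite Hj; simpl; field; apply C1_nz).
assert (Heq : forall t, upper_half_plane t -> holomorphic_at Z t ->
  holomorphic_at Z (t + RtoC h)%C -> Z (t + RtoC h)%C = (beta * Z t)%C).
{ intros t A1 A2 A3. rewrite <- Hm in A3 |- *.
  rewrite (slash_eigen_mul k Z _ beta t Hb A1), Hj; trivial.
  - rewrite Cpow_1_l; ring.
  - rewrite Hj; apply C1_nz. }
assert (Ch : continuous (fun t => (t + RtoC h)%C) t0)
  by (apply continuous_Cplus; [apply continuous_id | apply continuous_const]).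
assert (Hn := Ch _ (locally_holomorphic_at _ _ HZ1)). unfold filtermap in Hn.
assert (Hn0 : locally t0 (fun t => Z (t + RtoC h)%C <> 0%C)).
{ apply (continuous_neq (fun t => Z (t + RtoC h)%C)); trivial.
  apply (continuous_comp (fun t => (t + RtoC h)%C) Z); trivial.
  now apply holomorphic_at_continuous. }
assert (Hp : locally' t0 (fun t => Z (t + RtoC h)%C = (beta * Z t)%C /\
  Z (t + RtoC h)%C <> 0%C)).
{ assert (Hp := meromorphic_punctured Z t0 (HZ t0 Ht0)). unfold locally', within in *.
  generalize (filter_and _ _ (filter_and _ _ Hp Hn0)
    (filter_and _ _ Hn (locally_upper_half_plane t0 Ht0))).
  apply filter_imp; intros t [[A1 A2] [A3 A4]] Hne; auto. }
(* [Z] does not vanish at [t0 + h], whereas [beta = 0] would make it vanish near that point. *)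
assert (Hb0 : beta <> 0%C).
{ intros E. destruct (exists_punctured _ _ Hp) as [t [_ [A1 A2]]].
  apply A2. rewrite A1, E; ring. }
split; [exact Hb0 |].
assert (HZ0 : holomorphic_at Z t0).
{ apply (holomorphic_at_of_punctured_eq Z (fun t => (/ beta * Z (t + RtoC h))%C)).
  - now apply HZ.
  - apply continuous_Cmult; [apply continuous_const |].
    apply (continuous_comp (fun t => (t + RtoC h)%C) Z); trivial.
    now apply holomorphic_at_continuous.
  - unfold locally', within in *. revert Hp; apply filter_imp; intros t Ht Hne.
    destruct (Ht Hne) as [-> _]. field; trivial. }
generalize (filter_and _ _ (locally_holomorphic_at _ _ HZ0)
    (filter_and _ _ Hn (locally_upper_half_plane t0 Ht0))).
apply filter_imp; intros t [A1 [A2 A3]]; auto.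
Qed.

(** * The points tau0 and tau1 and the derivatives there *)

Lemma fricke_point (a b c n : R) :
  in_SL2 (Mat2 a b c (- a)) -> c <> 0 -> 0 < n ->
  let g := Mat2 a b c (- a) in
  let t0 := (RtoC (a / c) + Ci / RtoC (c * n))%C in
  let t1 := mobius g t0 in
  automorphy g t0 = (Ci / RtoC n)%C /\
  (RtoC (n * n) * t0 + RtoC (a / c * (1 - n * n)))%C = t1 /\
  Im t0 = / (c * n) /\ Im t1 = n / c.
Proof.
intros Hdet Hc Hn g t0 t1. unfold in_SL2 in Hdet; simpl in Hdet.
assert (Hcn : c * n <> 0) by (apply Rmult_integral_contrapositive_currified; lra).
assert (Hc0 : RtoC c <> 0%C) by (intros E; injection E; lra).
assert (Hn0 : RtoC n <> 0%C) by (intros E; injection E; lra).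
assert (Et0 : t0 = (RtoC a / RtoC c + Ci / (RtoC c * RtoC n))%C).
{ unfold t0. now rewrite RtoC_div, RtoC_mult by lra. }
assert (Ej : automorphy g t0 = (Ci / RtoC n)%C).
{ unfold automorphy; simpl. rewrite Et0, RtoC_opp. field; auto. }
assert (E : RtoC b = ((- (1) - RtoC a * RtoC a) / RtoC c)%C).
{ rewrite <- RtoC_mult, <- RtoC_opp, <- RtoC_minus, <- RtoC_div by lra.
  f_equal. field_simplify_eq; lra. }
(* Since b c = - 1 - a^2, the map is t -> a / c - 1 / (c (c t - a)), evaluated where c t - a = i /
   n. *)
assert (Et1 : t1 = (RtoC (a / c) + Ci * RtoC (n / c))%C).
{ unfold t1, mobius. rewrite Ej; simpl. rewrite E, Et0, !RtoC_div by lra.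
  assert (Ei : (Ci * Ci)%C = (- (1))%C) by (apply injective_projections; simpl; ring).
  transitivity ((RtoC a / RtoC c + - (1) / Ci * (RtoC n / RtoC c)))%C.
  - field. repeat split; trivial; apply Ci_nz.
  - rewrite <- Ei. field. repeat split; trivial; apply Ci_nz. }
repeat split; trivial.
- rewrite Et1, Et0, !RtoC_mult, RtoC_minus, RtoC_mult, !RtoC_div by lra. field; auto.
- unfold t0, Cdiv. rewrite <- RtoC_inv by trivial. simpl; ring.
- rewrite Et1. simpl; ring.
Qed.

Lemma fricke_derivatives (Z : C -> C) (k N : nat) (a b c : R) (alpha beta : C) :
  let n := sqrt (INR N) in
  let g := Mat2 a b c (- a) in
  let t0 := (RtoC (a / c) + Ci / RtoC (c * n))%C in
  let t1 := mobius g t0 in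
  (1 <= N)%nat -> in_SL2 g -> 0 < c -> meromorphic_on upper_half_plane Z ->
  slash_eigen k Z g alpha -> slash_eigen k Z (Mat2 1 (a / c * (1 - INR N)) 0 1) beta ->
  holomorphic_at Z t0 -> Z t0 <> 0%C ->
  beta <> 0%C /\ Z t1 <> 0%C /\ holomorphic_at Z t1 /\
  Z t1 = (alpha * (Ci / RtoC n) ^ k * Z t0)%C /\
  (RtoC (INR N) * C_derive Z t1 * Z t0
    = Z t1 * (Ci * RtoC (INR k) * RtoC c * RtoC n * Z t0 - C_derive Z t0))%C /\
  C_derive (multiplier N Z) t0
    = (beta * (C_derive Z t0 * Z t1 - RtoC (INR N) * Z t0 * C_derive Z t1)
        / (Z t1 * Z t1))%C.
Proof.
intros n g t0 t1 HN Hg Hc HZ Ha Hb HZ0 Hz0.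
assert (PN : 0 < INR N) by (apply lt_0_INR; lia).
assert (Pn : 0 < n) by now apply sqrt_lt_R0.
assert (EN : n * n = INR N) by (apply sqrt_sqrt; lra).
destruct (fricke_point a b c n Hg ltac:(lra) Pn) as [Ej [Eh [Hi0 Hi1]]].
fold g t0 in Ej, Eh, Hi0, Hi1. fold t1 in Eh, Hi1. rewrite EN in Eh.
assert (Hu0 : upper_half_plane t0).
{ unfold upper_half_plane. rewrite Hi0. apply Rinv_0_lt_compat. nra. }
assert (Hu1 : upper_half_plane t1).
{ unfold upper_half_plane. rewrite Hi1. now apply Rdiv_lt_0_compat. }
assert (HuN : upper_half_plane (RtoC (INR N) * t0)%C).
{ unfold upper_half_plane in *. rewrite im_scal_l. nra. }
assert (Hn0 : RtoC n <> 0%C) by (intros E; injection E; lra).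
assert (Hj : automorphy g t0 <> 0%C).
{ rewrite Ej. apply Cmult_neq_0; [apply Ci_nz |]. intros E. apply C1_nz.
  rewrite <- (Cinv_l (RtoC n)), E by trivial; ring. }
destruct (slash_eigen_involution Z k a b c alpha t0 Hg HZ Ha Hu0 Hu1 Hj HZ0 Hz0)
  as [HZ1 [Hz1 Hloc]]. fold g in HZ1, Hz1, Hloc. fold t1 in HZ1, Hz1.
destruct (slash_eigen_translation Z k (a / c * (1 - INR N)) beta (RtoC (INR N) * t0)%C
  HZ Hb HuN) as [Hb0 Htr]; [now rewrite Eh | now rewrite Eh |].
assert (Ez1 := locally_singleton _ _ Hloc). cbv beta in Ez1. fold t1 in Ez1.
assert (D0 := is_cderive_holomorphic Z t0 HZ0).
assert (D1 := is_cderive_holomorphic Z t1 HZ1).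
repeat split; trivial.
- now rewrite <- Ej.
- assert (L := is_cderive_comp Z (mobius g) t0 _ _ D1 (is_cderive_mobius g t0 Hg Hj)).
  assert (Rr := is_cderive_mult (fun t => alpha * automorphy g t ^ k)%C Z t0 _ _
    (is_cderive_scal alpha _ _ _ (is_cderive_pow _ _ _ k (is_cderive_automorphy g t0))) D0).
  apply (is_cderive_ext_loc _ (fun t => (alpha * automorphy g t ^ k * Z t)%C) _ _ Hloc) in L.
  assert (E := is_cderive_unique _ _ _ _ L Rr). cbv beta in E. clear L Rr.
  rewrite Ez1. rewrite Ej in E |- *. simpl m21 in E.
  assert (Ei : (Ci * Ci)%C = (- (1))%C) by (apply injective_projections; simpl; ring).
  (* The left side is the derivative of [mobius g] at [t0]; its value is - N. *)
  assert (E2 : (/ (Ci / RtoC n * (Ci / RtoC n)))%C = (- (RtoC n * RtoC n))%C).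
  { transitivity (RtoC n * RtoC n / (Ci * Ci))%C.
    - field; split; trivial; apply Ci_nz.
    - rewrite Ei. field. }
  rewrite E2 in E. rewrite <- EN, RtoC_mult.
  (* Raising the exponent from [pred k] to [k] exposes the factor that occurs in [Z t1]; for k = 0
     both sides are 0 thanks to [INR k]. *)
  assert (Ek : (RtoC (INR k) * (Ci / RtoC n) ^ pred k)%C
    = (RtoC (INR k) * (- Ci * RtoC n) * (Ci / RtoC n) ^ k)%C).
  { destruct k as [|k]; [simpl; ring |]. rewrite Cpow_S. simpl pred.
    transitivity (RtoC (INR (S k)) * (- (Ci * Ci)) * (Ci / RtoC n) ^ k)%C;
      [rewrite Ei; ring | field; trivial]. }
  rewrite Ek in E.
  transitivity (- (- (RtoC n * RtoC n) * C_derive Z t1) * Z t0)%C; [ring |].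
  rewrite E. ring.
- apply is_C_derive_unique.
  set (h := (a / c * (1 - INR N))) in *.
  apply (is_cderive_ext_loc (fun t => (beta * (Z t / Z (RtoC (INR N) * t + RtoC h)))%C)).
  + assert (Cn : continuous (fun t => (RtoC (INR N) * t)%C) t0)
      by (apply continuous_Cmult; [apply continuous_const | apply continuous_id]).
    assert (H1 := Cn _ Htr). unfold filtermap in H1.
    (* By the translation equation this also keeps Z(N t) away from 0, so the multiplier can be
       rewritten. *)
    assert (Hzz : locally t0 (fun t => Z (RtoC (INR N) * t + RtoC h)%C <> 0%C)).
    { apply (continuous_neq (fun t => Z (RtoC (INR N) * t + RtoC h)%C)); [| now rewrite Eh].
      apply (continuous_comp (fun t => RtoC (INR N) * t + RtoC h)%C Z).
      - apply continuous_Cplus; [exact Cn | apply continuous_const].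
      - rewrite Eh. now apply holomorphic_at_continuous. }
    generalize (filter_and _ _ H1 Hzz). apply filter_imp; intros t [A1 A2].
    unfold multiplier. rewrite A1 in A2 |- *.
    field. split; trivial. intros E; apply A2; rewrite E; ring.
  + eapply is_cderive_eq.
    * apply is_cderive_scal, is_cderive_div; [exact D0 | |].
      -- apply (is_cderive_comp Z (fun t => (RtoC (INR N) * t + RtoC h)%C)).
         ++ rewrite Eh. exact D1.
         ++ apply is_cderive_plus; [apply is_cderive_scal, is_cderive_id | apply is_cderive_const].
      -- now rewrite Eh.
    * cbv beta. rewrite Eh. field; trivial.
Qed.

Lemma Rpower_half_nat (x : R) (k : nat) :
  0 < x -> Rpower x (INR k / 2) = sqrt x ^ k.
Proof.
intros Hx. replace (INR k / 2) with (/ 2 * INR k) by field.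
rewrite <- Rpower_mult, Rpower_sqrt by trivial. apply Rpower_pow. now apply sqrt_lt_R0.
Qed.

(** The elimination in the abstract: [z0], [d0] and [z1], [d1] are the values of Z and Z' at tau0
    and tau1, [p] is 2 pi i, [K] is i k c sqrt N, and [G] is U X dM_N/dX at tau0, so that p G z0 is
    the derivative of the multiplier. The hypotheses give the sum and the difference of d0 / z0 and
    N d1 / z1. *)
Lemma fricke_log_derivatives (p K N z0 z1 d0 d1 beta G : C) :
  z0 <> 0%C -> z1 <> 0%C -> beta <> 0%C ->
  (N * d1 * z0)%C = (z1 * (K * z0 - d0))%C ->
  (p * (G * z0))%C = (beta * (d0 * z1 - N * z0 * d1) / (z1 * z1))%C ->
  K = (2 * (d0 / z0) - p * (G * z1 / beta))%C /\
  K = (2 * N * (d1 / z1) + p * (G * z1 / beta))%C.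
Proof.
intros Hz0 Hz1 Hb H1 H2.
assert (EG : (p * (G * z1 / beta))%C = ((d0 * z1 - N * z0 * d1) / (z1 * z0))%C).
{ transitivity (p * (G * z0) * (z1 / (beta * z0)))%C; [| rewrite H2]; field; auto. }
assert (EK : K = ((N * d1 * z0 / z1 + d0) / z0)%C) by (rewrite H1; field; auto).
rewrite EG, EK. split; field; auto.
Qed.

Theorem theorem1p1
  (Z X U : C -> C) (D : C -> Prop) (e0 e1 : R) (Xe0 Xe1 : C -> C) (A : nat -> C)
  (alpha beta : C) (N k : nat) (a b c : R)
  (Z_mero : meromorphic_on upper_half_plane Z)
  (X_mero : meromorphic_on upper_half_plane X)
  (U_mero : meromorphic_on upper_half_plane U)
  (X_ode : forall t, upper_half_plane t ->
     holomorphic_at X t -> holomorphic_at U t -> holomorphic_at Z t ->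
     (1 / (2 * RtoC PI * Ci) * C_derive X t = U t * X t * Z t)%C)
  (D_domain : complex_domain D)
  (D_sub : forall t, D t -> upper_half_plane t)
  (Xe0_branch : holomorphic_power D X e0 Xe0)
  (Xe1_branch : holomorphic_power D (fun t => (1 - X t)%C) e1 Xe1)
  (Z_series : forall t, D t -> holomorphic_at X t -> holomorphic_at Z t ->
     exists s : C, is_series (fun j : nat => (A j * X t ^ j)%C : C_NormedModule) s /\
       Z t = (Xe0 t * Xe1 t * s)%C)
  (N_pos : (1 <= N)%nat) (k_pos : (1 <= k)%nat) :
  let gamma := Mat2 a b c (- a) in
  let delta := Mat2 1 (a / c * (1 - INR N)) 0 1 in
  in_SL2 gamma -> in_SL2 delta ->
  slash_eigen k Z gamma alpha -> slash_eigen k Z delta beta ->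
  let tau0 := (RtoC (a / c) + Ci / RtoC (c * sqrt (INR N)))%C in
  let tau1 := mobius gamma tau0 in
  let dM := derive_wrt (multiplier N Z) X tau0 in
  holomorphic_at X tau0 -> holomorphic_at U tau0 -> holomorphic_at Z tau0 ->
  C_derive X tau0 <> 0%C ->
  (D tau0 ->
   (e1 <> 0 -> X tau0 <> 1%C) ->
   let aN :=
     (2 * (RtoC e0 + RtoC e1 * (X tau0 / (X tau0 - 1)))
      - alpha * Ci ^ k / (beta * RtoC (Rpower (INR N) (INR k / 2)))
        * X tau0 * dM)%C in
   exists s : C,
     is_series (fun j : nat =>
       ((2 * RtoC (INR j) + aN) * A j * X tau0 ^ j)%C : C_NormedModule) s /\
     RtoC (c * INR k * sqrt (INR N) / (2 * PI))
       = (U tau0 * Xe0 tau0 * Xe1 tau0 * s)%C)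
  /\
  (D tau1 ->
   holomorphic_at X tau1 -> holomorphic_at U tau1 -> holomorphic_at Z tau1 ->
   (e1 <> 0 -> X tau1 <> 1%C) ->
   let bN' := (2 * RtoC (INR N) * U tau1)%C in
   let aN' :=
     (2 * RtoC (INR N) * U tau1
        * (RtoC e0 + RtoC e1 * (X tau1 / (X tau1 - 1)))
      + 1 / beta * U tau0 * X tau0 * dM)%C in
   exists s : C,
     is_series (fun j : nat =>
       ((bN' * RtoC (INR j) + aN') * A j * X tau1 ^ j)%C : C_NormedModule) s /\
     RtoC (c * INR k * sqrt (INR N) / (2 * PI))
       = (Xe0 tau1 * Xe1 tau1 * s)%C).
Proof.
intros gamma delta Hg Hd Ha Hb tau0 tau1 dM HX0 HU0 HZ0 HdX0.
assert (Hode : forall t, upper_half_plane t ->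
  holomorphic_at X t -> holomorphic_at U t -> holomorphic_at Z t ->
  C_derive X t = (2 * RtoC PI * Ci * (U t * X t * Z t))%C).
{ intros t H1 H2 H3 H4. rewrite <- X_ode by trivial. field.
  split; [apply Ci_nz |]. intros E; injection E; apply PI_neq0. }
assert (PN : 0 < INR N) by (apply lt_0_INR; lia).
assert (Pn := sqrt_lt_R0 _ PN). set (n := sqrt (INR N)) in *.
(* With c = 0 the determinant condition would read - a^2 = 1. *)
assert (Hc0 : c <> 0).
{ intros E. unfold in_SL2 in Hg; simpl in Hg. subst c. nra. }
destruct (fricke_point a b c n Hg Hc0 Pn) as [_ [_ [Hi0 Hi1]]].
fold gamma tau0 in Hi0, Hi1. fold tau1 in Hi1.
(* The imaginary parts 1 / (c n) and n / c have the sign of [c]. *)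
assert (Hc : D tau0 \/ D tau1 -> 0 < c).
{ intros [HD | HD]; apply D_sub in HD; unfold upper_half_plane in HD.
  - rewrite Hi0 in HD. apply Rnot_le_lt; intros Hle.
    assert (H := Rinv_lt_0_compat (c * n) ltac:(nra)). lra.
  - rewrite Hi1 in HD. apply Rnot_le_lt; intros Hle.
    assert (H := Rinv_lt_0_compat c ltac:(lra)). unfold Rdiv in HD. nra. }
assert (Hu0 : 0 < c -> upper_half_plane tau0).
{ intros H. unfold upper_half_plane. rewrite Hi0. apply Rinv_0_lt_compat. nra. }
assert (Hfr : 0 < c ->
  U tau0 <> 0%C /\ Z tau0 <> 0%C /\ beta <> 0%C /\ Z tau1 <> 0%C /\
  Z tau1 = (alpha * (Ci / RtoC n) ^ k * Z tau0)%C /\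
  (RtoC (INR N) * C_derive Z tau1 * Z tau0
    = Z tau1 * (Ci * RtoC (INR k) * RtoC c * RtoC n * Z tau0 - C_derive Z tau0))%C /\
  (2 * RtoC PI * Ci * (U tau0 * X tau0 * Z tau0) * dM)%C
    = (beta * (C_derive Z tau0 * Z tau1 - RtoC (INR N) * Z tau0 * C_derive Z tau1)
        / (Z tau1 * Z tau1))%C).
{ intros Hpos. assert (HX' := Hode tau0 (Hu0 Hpos) HX0 HU0 HZ0).
  (* By the differential equation a zero of [U] or [Z] at tau0 would be a zero of X'. *)
  assert (Hnz : (U tau0 <> 0 /\ Z tau0 <> 0)%C).
  { repeat split; intros E; apply HdX0; rewrite HX', E; ring. }
  destruct Hnz as [H1 H2]. repeat (split; [assumption |]).
  destruct (fricke_derivatives Z k N a b c alpha beta N_pos Hg Hpos Z_mero Ha Hb HZ0 H2)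
    as [F1 [F2 [_ [F4 [F5 F6]]]]].
  repeat (split; [assumption |]).
  rewrite <- HX'. unfold dM, derive_wrt. unfold tau0, n in F6 |- *. rewrite F6.
  fold n. fold tau0. fold gamma. fold tau1. field; auto. }
assert (Hrep := fun t HD => derive_of_series_representation Z X U D e0 e1 Xe0 Xe1 A t
  (proj1 (proj2 D_domain)) HD (fun w Hw => Hode w (D_sub w Hw))
  Xe0_branch Xe1_branch Z_series).
assert (Hn0 : RtoC n <> 0%C) by (intros E; injection E; lra).
assert (HPI : RtoC PI <> 0%C) by (intros E; injection E; apply PI_neq0).
assert (ELHS : forall W, (Ci * RtoC (INR k) * RtoC c * RtoC n)%C = (2 * RtoC PI * Ci * W)%C ->
  RtoC (c * INR k * n / (2 * PI)) = W).
{ intros W HW. assert (H2PI := PI_neq0).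
  rewrite RtoC_div, !RtoC_mult by lra.
  transitivity ((Ci * RtoC (INR k) * RtoC c * RtoC n) / (2 * RtoC PI * Ci))%C;
    [| rewrite HW]; field; split; trivial; apply Ci_nz. }
split.
- intros HD HX1 aN. specialize (Hc (or_introl HD)).
  destruct (Hfr Hc) as [HU [HZ [Hbeta [Hz1 [F4 [F5 F6]]]]]].
  destruct (Hrep tau0 HD HX0 HU0 HZ0 HZ HX1) as [s0 [s1 [S0 [S1 [EZ EdZ]]]]].
  (* [s1] carries the factor [U tau0], nonzero here; the statement puts it outside the sum. *)
  exists (2 / U tau0 * s1 + aN * s0)%C; split.
  + eapply (is_series_ext (K := C_AbsRing) (V := C_NormedModule));
      [| exact (is_cseries_lin (2 / U tau0) aN _ _ _ _ S1 S0)].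
    intros j. cbv beta. generalize (X tau0 ^ j)%C; intros x. clearbody aN.
    change ((2 / U tau0 * (U tau0 * RtoC (INR j) * A j * x) + aN * (A j * x))%C
      = ((2 * RtoC (INR j) + aN) * A j * x)%C). field; trivial.
  + apply ELHS.
    destruct (fricke_log_derivatives (2 * RtoC PI * Ci) (Ci * RtoC (INR k) * RtoC c * RtoC n)
      (RtoC (INR N)) _ _ _ _ _ (U tau0 * X tau0 * dM) HZ Hz1 Hbeta F5) as [-> _];
      [rewrite <- F6; ring |].
    (* This is [F4] with N^(k/2) written as the k-th power of [n]. *)
    assert (Emu : (alpha * Ci ^ k / (beta * RtoC (Rpower (INR N) (INR k / 2))))%C
      = (Z tau1 / (beta * Z tau0))%C).
    { rewrite Rpower_half_nat by exact PN. fold n. rewrite RtoC_pow, F4.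
      unfold Cdiv at 3. rewrite Cpow_mult_l, Cpow_inv by exact Hn0.
      field. repeat split; trivial. now apply Cpow_nz. }
    unfold aN. rewrite Emu, EdZ.
    set (E := (RtoC e0 + RtoC e1 * (X tau0 / (X tau0 - 1)))%C).
    (* The multiplier term is given the common factor [Xe0 tau0 * Xe1 tau0] by expanding one
       [Z tau0] with [EZ]. *)
    transitivity (2 * RtoC PI * Ci * (2 * (Xe0 tau0 * Xe1 tau0 * (s1 + U tau0 * E * s0))
      - U tau0 * X tau0 * dM * Z tau1 / (beta * Z tau0) * (Xe0 tau0 * Xe1 tau0 * s0)))%C.
    * rewrite <- EZ. field; auto.
    * field; auto.
- intros HD HX1h HU1h HZ1h HX1 bN' aN'. specialize (Hc (or_intror HD)).
  destruct (Hfr Hc) as [HU [HZ [Hbeta [Hz1 [F4 [F5 F6]]]]]].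
  destruct (Hrep tau1 HD HX1h HU1h HZ1h Hz1 HX1) as [s0 [s1 [S0 [S1 [EZ EdZ]]]]].
  (* [U tau1] may be zero, so it stays inside [s1] and appears in [bN'] instead of being divided
     out. *)
  exists (2 * RtoC (INR N) * s1 + aN' * s0)%C; split.
  + eapply (is_series_ext (K := C_AbsRing) (V := C_NormedModule));
      [| exact (is_cseries_lin (2 * RtoC (INR N)) aN' _ _ _ _ S1 S0)].
    intros j. cbv beta. generalize (X tau1 ^ j)%C; intros x. unfold bN'. clearbody aN'.
    change ((2 * RtoC (INR N) * (U tau1 * RtoC (INR j) * A j * x) + aN' * (A j * x))%C
      = ((2 * RtoC (INR N) * U tau1 * RtoC (INR j) + aN') * A j * x)%C). ring.
  + apply ELHS.
    destruct (fricke_log_derivatives (2 * RtoC PI * Ci) (Ci * RtoC (INR k) * RtoC c * RtoC n)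
      (RtoC (INR N)) _ _ _ _ _ (U tau0 * X tau0 * dM) HZ Hz1 Hbeta F5) as [_ ->];
      [rewrite <- F6; ring |].
    unfold aN'. rewrite EdZ.
    set (E := (RtoC e0 + RtoC e1 * (X tau1 / (X tau1 - 1)))%C).
    (* Here [EZ] expands [Z tau1], the very value in the multiplier term, so only the division by
       [beta] remains. *)
    transitivity (2 * RtoC PI * Ci
      * (2 * RtoC (INR N) * (Xe0 tau1 * Xe1 tau1 * (s1 + U tau1 * E * s0))
      + U tau0 * X tau0 * dM / beta * (Xe0 tau1 * Xe1 tau1 * s0)))%C.
    * rewrite <- EZ. field; auto.
    * field; auto.
Qed.
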